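(* Consider the scheme with topography $q_i^{n+1}=q_i^n-\frac{\Delta t}{\Delta x_i}\big(F_l(q_i^n,q_{i+1}^n,\Delta b_{i+1/2})-F_r(q_{i-1}^n,q_i^n,\Delta b_{i-1/2})\big)$, $\Delta b_{i+1/2}=b_{i+1}-b_i$, with the hydrostatically reconstructed fluxes described in the context. Then: (i) it is consistent with the system with topography of the context for smooth solutions; (ii) it keeps the positivity (nonnegativity) of $h,\sigma_{xx},\sigma_{zz}$ under the CFL condition $\Delta t\,A(q_l^\sharp,q_r^\sharp)\le\frac12\min(\Delta x_l,\Delta x_r)$ at every interface, where $q_l^\sharp,q_r^\sharp$ are the reconstructed states at that interface and $\Delta x_l,\Delta x_r$ the lengths of the adjacent cells; (iii) it is conservative in the variable $h$; (iv) it satisfies a semi-discrete energy inequality associated with $\partial_t\widetilde E+\partial_x\widetilde G\le0$: there exists a numerical energy flux $\widetilde{\mathcal G}(q_l,q_r,b_l,b_r)$ with $\widetilde{\mathcal G}(q,q,b,b)=\widetilde G(q,b)$ such that for all left/right data $\widetilde G(q_r,b_r)+\partial_q\widetilde E(q_r,b_r)\cdot\big(F_r(q_l,q_r,\Delta b)-F(q_r)\big)\le\widetilde{\mathcal G}(q_l,q_r,b_l,b_r)\le\widetilde G(q_l,b_l)+\partial_q\widetilde E(q_l,b_l)\cdot\big(F_l(q_l,q_r,\Delta b)-F(q_l)\big)$, where $\Delta b=b_r-b_l$ (these inequalities ensure that solutions of the semi-discrete scheme $\frac{d}{dt}q_i+\frac1{\Delta x_i}(F_l(q_i,q_{i+1},\Delta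 b_{i+1/2})-F_r(q_{i-1},q_i,\Delta b_{i-1/2}))=0$ satisfy $\frac{d}{dt}\widetilde E(q_i,b_i)+\frac1{\Delta x_i}(\widetilde{\mathcal G}_{i+1/2}-\widetilde{\mathcal G}_{i-1/2})\le0$); (v) it is well-balanced: it preserves the steady states at rest, i.e. if $u_i^n=0$, $h_i^n+b_i$ is independent of $i$ and $\sigma_{xx,i}^n=\sigma_{zz,i}^n=1$ for all $i$, then $q_i^{n+1}=q_i^n$ for all $i$.
   Context: System with topography $b(x)$ (given), constants $g,\eta_p,\lambda>0$: $\partial_th+\partial_x(hu)=0$, $\partial_t(hu)+\partial_x(hu^2+P)=-gh\partial_xb$, $\partial_t(h\sigma_{xx})+\partial_x(h\sigma_{xx}u)-2h\sigma_{xx}\partial_xu=0$, $\partial_t(h\sigma_{zz})+\partial_x(h\sigma_{zz}u)+2h\sigma_{zz}\partial_xu=0$, with $P=g\frac{h^2}{2}+\frac{\eta_p}{2\lambda}h(\sigma_{zz}-\sigma_{xx})$. State $q=(h,hu,h\sigma_{xx},h\sigma_{zz})$; $F(q)=(hu,\ hu^2+P,\ h\sigma_{xx}u,\ h\sigma_{zz}u)$. Energy $E(q)=h\frac{u^2}2+g\frac{h^2}{2}+\frac{\eta_p}{4\lambda}h(\sigma_{xx}+\sigma_{zz}-\ln(\sigma_{xx}\sigma_{zz})-2)$, $G(q)=(E+P)u$, $\widetilde E(q,b)=E(q)+ghb$, $\widetilde G(q,b)=G(q)+ghbu$; $\partial_q\widetilde E$ is the gradient of $\widetilde E$ with respect to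 $q$ at fixed $b$. Homogeneous solver (without topography): for states $q_l,q_r$, with $\partial_hP|_{\boldsymbol s}=gh+\frac{\eta_p}{2\lambda}(3\sigma_{zz}+\sigma_{xx})$, $P_{l,r}=P(q_{l,r})$, $a_{l,r}=\sqrt{\partial_hP|_{\boldsymbol s}(q_{l,r})}$, speeds $\frac{c_l}{h_l}=a_l+2\big(\max(0,u_l-u_r)+\frac{\max(0,P_r-P_l)}{h_la_l+h_ra_r}\big)$, $\frac{c_r}{h_r}=a_r+2\big(\max(0,u_l-u_r)+\frac{\max(0,P_l-P_r)}{h_la_l+h_ra_r}\big)$; $\pi_l=P_l,\pi_r=P_r$, $u^*=\frac{c_lu_l+c_ru_r+\pi_l-\pi_r}{c_l+c_r}$, $\pi^*=\frac{c_r\pi_l+c_l\pi_r-c_lc_r(u_r-u_l)}{c_l+c_r}$, $\frac1{h_l^*}=\frac1{h_l}+\frac{c_r(u_r-u_l)+\pi_l-\pi_r}{c_l(c_l+c_r)}$, $\frac1{h_r^*}=\frac1{h_r}+\frac{c_l(u_r-u_l)+\pi_r-\pi_l}{c_r(c_l+c_r)}$, $\sigma_{xx,l}^*=\sigma_{xx,l}(h_l/h_l^* )^2$, $\sigma_{xx,r}^*=\sigma_{xx,r}(h_r/h_r^* )^2$, $\sigma_{zz,l}^*=\sigma_{zz,l}(h_l^*/h_l)^2$, $\sigma_{zz,r}^*=\sigma_{zz,r}(h_r^*/h_r)^2$, $q_{l}^*=(h_l^*,h_l^*u^*,h_l^*\sigma^*_{xx,l},h_l^*\sigma^*_{zz,l})$,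 $q_r^*$ similarly; $\Sigma_1=u_l-c_l/h_l$, $\Sigma_2=u^*$, $\Sigma_3=u_r+c_r/h_r$; the self-similar solution equals $q_l$ ($\pi=\pi_l$) for $\xi<\Sigma_1$, $q_l^*$ ($\pi=\pi^*$) on $(\Sigma_1,\Sigma_2)$, $q_r^*$ ($\pi=\pi^*$) on $(\Sigma_2,\Sigma_3)$, $q_r$ ($\pi=\pi_r$) for $\xi>\Sigma_3$. Homogeneous fluxes $\mathcal F_l=(\mathcal F^h,\mathcal F^{hu},\mathcal F_l^{h\sigma_{xx}},\mathcal F_l^{h\sigma_{zz}})$, $\mathcal F_r=(\mathcal F^h,\mathcal F^{hu},\mathcal F_r^{h\sigma_{xx}},\mathcal F_r^{h\sigma_{zz}})$ with $\mathcal F^h=hu$, $\mathcal F^{hu}=hu^2+\pi$ evaluated at $\xi=0$, and for $w\in\{h\sigma_{xx},h\sigma_{zz}\}$: $\mathcal F_l^w=(wu)_l+\min(0,\Sigma_1)(w_l^*-w_l)+\min(0,\Sigma_2)(w_r^*-w_l^* )+\min(0,\Sigma_3)(w_r-w_r^* )$, $\mathcal F_r^w=(wu)_r-\max(0,\Sigma_1)(w_l^*-w_l)-\max(0,\Sigma_2)(w_r^*-w_l^* )-\max(0,\Sigma_3)(w_r-w_r^* )$. $A(q_l,q_r)=\max(|\Sigma_1|,|\Sigma_2|,|\Sigma_3|)$. The homogeneous solver is understood as extended to vacuum states ($h=0$) in the relaxation framework it comes from. Hydrostatic reconstruction: with $x_+=\max(0,x)$ and $\Delta b=b_r-b_l$,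 $h_l^\sharp=(h_l-(\Delta b)_+)_+$, $h_r^\sharp=(h_r-(-\Delta b)_+)_+$, $q_l^\sharp=(h_l^\sharp,h_l^\sharp u_l,h_l^\sharp\sigma_{xx,l},h_l^\sharp\sigma_{zz,l})$, $q_r^\sharp=(h_r^\sharp,h_r^\sharp u_r,h_r^\sharp\sigma_{xx,r},h_r^\sharp\sigma_{zz,r})$, and $F_l(q_l,q_r,\Delta b)=\mathcal F_l(q_l^\sharp,q_r^\sharp)+(0,\ g h_l^2/2-g(h_l^\sharp)^2/2,\ 0,\ 0)$, $F_r(q_l,q_r,\Delta b)=\mathcal F_r(q_l^\sharp,q_r^\sharp)+(0,\ gh_r^2/2-g(h_r^\sharp)^2/2,\ 0,\ 0)$. Mesh: cells of length $\Delta x_i$, cell values $b_i$ of the topography, time step $\Delta t$. *)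

(* Defs.v *)
From Stdlib Require Import Reals ZArith.
From Coquelicot Require Import Coquelicot.
Open Scope R_scope.

(** States are stored in primitive variables (h, u, sigma_xx, sigma_zz);
    the conserved vector is q = (h, hu, h sigma_xx, h sigma_zz) = [cons s].
    Storing primitive variables lets vacuum states (h = 0), in particular the
    hydrostatically reconstructed states h^# = 0, keep the velocity / stresses
    of the cell they come from. *)
Record st := mkst { sh : R; su : R; sxx : R; szz : R }.

Record v4 := mkv4 { c1 : R; c2 : R; c3 : R; c4 : R }.
Definition v4add (a b : v4) := mkv4 (c1 a + c1 b) (c2 a + c2 b) (c3 a + c3 b) (c4 a + c4 b).
Definition v4sub (a b : v4) := mkv4 (c1 a - c1 b) (c2 a - c2 b) (c3 a - c3 b) (c4 a - c4 b).
Definition v4scal (k : R) (a : v4) := mkv4 (k * c1 a) (k * c2 a) (k * c3 a) (k * c4 a).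

Definition cons (q : st) : v4 :=
  mkv4 (sh q) (sh q * su q) (sh q * sxx q) (sh q * szz q).

Section Model.
Variables g eta_p lam : R.

Definition Pres (q : st) : R :=
  g * sh q ^ 2 / 2 + eta_p / (2 * lam) * sh q * (szz q - sxx q).

(** d_h P|_s = g h + eta_p/(2 lambda) (3 szz + sxx) *)
Definition dhP (q : st) : R := g * sh q + eta_p / (2 * lam) * (3 * szz q + sxx q).

Definition Flux (q : st) : v4 :=
  mkv4 (sh q * su q) (sh q * su q ^ 2 + Pres q) (sh q * sxx q * su q) (sh q * szz q * su q).

Section Solver.
Variables ql qr : st.
Let hl := sh ql.  Let hr := sh qr.
Let ul := su ql.  Let ur := su qr.
Definition sol_al := sqrt (dhP ql).
Definition sol_ar := sqrt (dhP qr).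
Definition sol_Pl := Pres ql.
Definition sol_Pr := Pres qr.
(** s_l = c_l/h_l and s_r = c_r/h_r (speeds, defined also in vacuum) *)
Definition sol_sl := sol_al + 2 * (Rmax 0 (ul - ur)
                      + Rmax 0 (sol_Pr - sol_Pl) / (hl * sol_al + hr * sol_ar)).
Definition sol_sr := sol_ar + 2 * (Rmax 0 (ul - ur)
                      + Rmax 0 (sol_Pl - sol_Pr) / (hl * sol_al + hr * sol_ar)).
Definition sol_cl := hl * sol_sl.
Definition sol_cr := hr * sol_sr.
Definition sol_ustar :=
  (sol_cl * ul + sol_cr * ur + sol_Pl - sol_Pr) / (sol_cl + sol_cr).
Definition sol_pistar :=
  (sol_cr * sol_Pl + sol_cl * sol_Pr - sol_cl * sol_cr * (ur - ul)) / (sol_cl + sol_cr).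
(** intermediate depths; a vacuum side (h = 0) has a vacuum intermediate state *)
Definition sol_hls :=
  if Rle_dec hl 0 then 0
  else / (/ hl + (sol_cr * (ur - ul) + sol_Pl - sol_Pr) / (sol_cl * (sol_cl + sol_cr))).
Definition sol_hrs :=
  if Rle_dec hr 0 then 0
  else / (/ hr + (sol_cl * (ur - ul) + sol_Pr - sol_Pl) / (sol_cr * (sol_cl + sol_cr))).
Definition sol_sxxls := sxx ql * (hl / sol_hls) ^ 2.
Definition sol_sxxrs := sxx qr * (hr / sol_hrs) ^ 2.
Definition sol_szzls := szz ql * (sol_hls / hl) ^ 2.
Definition sol_szzrs := szz qr * (sol_hrs / hr) ^ 2.
Definition sol_qls : v4 :=
  mkv4 sol_hls (sol_hls * sol_ustar) (sol_hls * sol_sxxls) (sol_hls * sol_szzls).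
Definition sol_qrs : v4 :=
  mkv4 sol_hrs (sol_hrs * sol_ustar) (sol_hrs * sol_sxxrs) (sol_hrs * sol_szzrs).
Definition Sig1 := ul - sol_sl.
Definition Sig2 := sol_ustar.
Definition Sig3 := ur + sol_sr.

Definition Aspeed := Rmax (Rabs Sig1) (Rmax (Rabs Sig2) (Rabs Sig3)).

(** (h, u, pi) of the self-similar solution at xi = 0 *)
Definition at0 : R * R * R :=
  if Rlt_dec 0 Sig1 then (hl, ul, sol_Pl)
  else if Rlt_dec 0 Sig2 then (sol_hls, sol_ustar, sol_pistar)
  else if Rlt_dec 0 Sig3 then (sol_hrs, sol_ustar, sol_pistar)
  else (hr, ur, sol_Pr).
Definition flux_h := let '(h, u, _) := at0 in h * u.
Definition flux_hu := let '(h, u, p) := at0 in h * u ^ 2 + p.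

(** w-fluxes, w in {h sxx, h szz}: wl, wls, wrs, wr are the values of w in
    q_l, q_l^*, q_r^*, q_r and wul, wur the values of w u in q_l, q_r. *)
Definition flux_wl (wl wls wrs wr wul : R) :=
  wul + Rmin 0 Sig1 * (wls - wl) + Rmin 0 Sig2 * (wrs - wls) + Rmin 0 Sig3 * (wr - wrs).
Definition flux_wr (wl wls wrs wr wur : R) :=
  wur - Rmax 0 Sig1 * (wls - wl) - Rmax 0 Sig2 * (wrs - wls) - Rmax 0 Sig3 * (wr - wrs).

Definition solFl : v4 :=
  mkv4 flux_h flux_hu
    (flux_wl (c3 (cons ql)) (c3 sol_qls) (c3 sol_qrs) (c3 (cons qr)) (c3 (Flux ql)))
    (flux_wl (c4 (cons ql)) (c4 sol_qls) (c4 sol_qrs) (c4 (cons qr)) (c4 (Flux ql))).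
Definition solFr : v4 :=
  mkv4 flux_h flux_hu
    (flux_wr (c3 (cons ql)) (c3 sol_qls) (c3 sol_qrs) (c3 (cons qr)) (c3 (Flux qr)))
    (flux_wr (c4 (cons ql)) (c4 sol_qls) (c4 sol_qrs) (c4 (cons qr)) (c4 (Flux qr))).
End Solver.

Definition recon_l (ql qr : st) (db : R) : st :=
  mkst (Rmax 0 (sh ql - Rmax 0 db)) (su ql) (sxx ql) (szz ql).
Definition recon_r (ql qr : st) (db : R) : st :=
  mkst (Rmax 0 (sh qr - Rmax 0 (- db))) (su qr) (sxx qr) (szz qr).

Definition Fl (ql qr : st) (db : R) : v4 :=
  v4add (solFl (recon_l ql qr db) (recon_r ql qr db))
        (mkv4 0 (g * sh ql ^ 2 / 2 - g * sh (recon_l ql qr db) ^ 2 / 2) 0 0).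
Definition Fr (ql qr : st) (db : R) : v4 :=
  v4add (solFr (recon_l ql qr db) (recon_r ql qr db))
        (mkv4 0 (g * sh qr ^ 2 / 2 - g * sh (recon_r ql qr db) ^ 2 / 2) 0 0).

Definition step (dt : R) (dx b : Z -> R) (q : Z -> st) (i : Z) : v4 :=
  v4sub (cons (q i))
    (v4scal (dt / dx i)
       (v4sub (Fl (q i) (q (i + 1)%Z) (b (i + 1)%Z - b i))
              (Fr (q (i - 1)%Z) (q i) (b i - b (i - 1)%Z)))).

Definition CFL (dt : R) (dx b : Z -> R) (q : Z -> st) (i : Z) : Prop :=
  let db := b (i + 1)%Z - b i in
  dt * Aspeed (recon_l (q i) (q (i + 1)%Z) db) (recon_r (q i) (q (i + 1)%Z) db)
    <= / 2 * Rmin (dx i) (dx (i + 1)%Z).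

(** tilde E as a function of the conserved variables (h, m=hu, X=h sxx, Z=h szz)
    and of b:  h u^2/2 + g h^2/2 + eta_p/(4 lam) h (sxx+szz-ln(sxx szz)-2) + g h b *)
Definition Etc (h m X Zz b : R) : R :=
  h * (m / h) ^ 2 / 2 + g * h ^ 2 / 2
  + eta_p / (4 * lam) * h * (X / h + Zz / h - ln ((X / h) * (Zz / h)) - 2)
  + g * h * b.

Definition Etil (q : st) (b : R) : R :=
  Etc (c1 (cons q)) (c2 (cons q)) (c3 (cons q)) (c4 (cons q)) b.
Definition Eng (q : st) : R := Etil q 0.

Definition Gtil (q : st) (b : R) : R :=
  (Eng q + Pres q) * su q + g * sh q * b * su q.

Definition dEtil_dot (q : st) (b : R) (v : v4) : R :=
  let Q := cons q in
  Derive (fun x => Etc x (c2 Q) (c3 Q) (c4 Q) b) (c1 Q) * c1 v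
  + Derive (fun x => Etc (c1 Q) x (c3 Q) (c4 Q) b) (c2 Q) * c2 v
  + Derive (fun x => Etc (c1 Q) (c2 Q) x (c4 Q) b) (c3 Q) * c3 v
  + Derive (fun x => Etc (c1 Q) (c2 Q) (c3 Q) x b) (c4 Q) * c4 v.

Definition wet (q : st) : Prop := 0 < sh q /\ 0 < sxx q /\ 0 < szz q.

Definition pdist (a b : st) : R :=
  Rabs (sh a - sh b) + Rabs (su a - su b) + Rabs (sxx a - sxx b) + Rabs (szz a - szz b).

(** (i) consistency: F_l(q,q,0) = F_r(q,q,0) = F(q), and the flux difference
    F_r - F_l discretizes the source / nonconservative terms of the system
    written as d_t q + d_x F(q) + B(q) d_x q = 0, i.e.
    (0, g h d_x b, -2 h sxx d_x u, 2 h szz d_x u):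
    F_r(ql,qr,db) - F_l(ql,qr,db)
      = -(0, g h db, -2 h sxx (ur-ul), 2 h szz (ur-ul)) + o(|qr-ql| + |db|)
    as ql, qr -> q, db -> 0. *)
Definition consistency : Prop :=
  (forall q, wet q -> Fl q q 0 = Flux q /\ Fr q q 0 = Flux q) /\
  (forall q, wet q -> forall eps, 0 < eps -> exists delta, 0 < delta /\
     forall ql qr db, pdist ql q < delta -> pdist qr q < delta -> Rabs db < delta ->
       let D := v4sub (Fr ql qr db) (Fl ql qr db) in
       let err := eps * (pdist qr ql + Rabs db) in
       Rabs (c1 D) <= err /\
       Rabs (c2 D - (- g * sh q * db)) <= err /\
       Rabs (c3 D - 2 * sh q * sxx q * (su qr - su ql)) <= err /\
       Rabs (c4 D - (- 2 * sh q * szz q * (su qr - su ql))) <= err).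

Definition positivity : Prop :=
  forall (dt : R) (dx b : Z -> R) (q : Z -> st),
    0 <= dt -> (forall i, 0 < dx i) ->
    (forall i, 0 <= sh (q i) /\ 0 <= sxx (q i) /\ 0 <= szz (q i)) ->
    (forall i, CFL dt dx b q i) ->
    forall i, 0 <= c1 (step dt dx b q i) /\ 0 <= c3 (step dt dx b q i)
              /\ 0 <= c4 (step dt dx b q i).

Definition conservative_h : Prop :=
  forall ql qr db, c1 (Fl ql qr db) = c1 (Fr ql qr db).

Definition energy_inequality : Prop :=
  exists Gn : st -> st -> R -> R -> R,
    (forall q b, wet q -> Gn q q b b = Gtil q b) /\
    (forall ql qr bl br, wet ql -> wet qr ->
       Gtil qr br + dEtil_dot qr br (v4sub (Fr ql qr (br - bl)) (Flux qr))
         <= Gn ql qr bl br /\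
       Gn ql qr bl br
         <= Gtil ql bl + dEtil_dot ql bl (v4sub (Fl ql qr (br - bl)) (Flux ql))).

Definition well_balanced : Prop :=
  forall (dt : R) (dx b : Z -> R) (q : Z -> st) (H : R),
    (forall i, 0 < dx i) ->
    (forall i, 0 <= sh (q i) /\ su (q i) = 0 /\ sh (q i) + b i = H
               /\ sxx (q i) = 1 /\ szz (q i) = 1) ->
    forall i, step dt dx b q i = cons (q i).

End Model.

(* Main.v *)
From Stdlib Require Import Reals ZArith Lra Psatz.
From Coquelicot Require Import Coquelicot.
Require Import Defs.
Open Scope R_scope.

(** The three waves satisfy [Sigma_1 <= u_star <= Sigma_3] because the speeds
    dominate the velocity drops: [u_l - u_star <= (c_l/h_l - a_l)/2] and likewise on
    the right. The fluxes then equal the exact ones at [q_l] (resp. [q_r]) plus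
    [sum_k min(0, Sigma_k) [q]_k] (resp. minus [sum_k max(0, Sigma_k) [q]_k]), with
    the same jumps on both sides, and a summation by parts turns nonnegativity of a
    function on the intermediate states into an inequality on the fluxes.
    Applied to [h], [h sigma] this gives positivity. Applied to the relaxed energy
    minus its tangent at [q_l] or [q_r], which is nonnegative by convexity of [E] and
    the subcharacteristic condition on [c_l], [c_r], it gives the energy inequality
    without topography.

    With topography, [dE] depends on [h] and [b] only through [g (h + b)], so the
    reconstruction only adds [g (h + b - h^#) F^h] on each side. These terms agree
    unless a reconstructed state is dry, in which case the mass flux enters it and the
    inequality has the right sign.

    For consistency, [F_r - F_l] depends to first order on the velocity
    differences through [(u_star - u_l) + (u_r - u_star) = u_r - u_l]. *)

(** * Elementary inequalities for velocities, updates and remainders *)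

(** The weight [c' / (c + c')] of [du] is at most one, and dividing a negative [dp] by the smaller
    [s] can only lower it. Here [s] stands for the acoustic impedance [h_l a_l + h_r a_r], so that
    the bound does not involve the speeds being defined. *)
Lemma contact_velocity_lower (c c' s du dp : R) :
  0 <= c -> 0 <= c' -> 0 < s <= c + c' ->
  - (Rmax 0 (- du) + Rmax 0 (- dp) / s) <= (c' * du + dp) / (c + c').
Proof.
intros Hc Hc' Hs.
assert (M1 := Rmax_l 0 (- du)); assert (M2 := Rmax_r 0 (- du)).
assert (M3 := Rmax_l 0 (- dp)); assert (M4 := Rmax_r 0 (- dp)).
set (U := Rmax 0 (- du)) in *; set (V := Rmax 0 (- dp)) in *.
apply Rmult_le_reg_r with (c + c'); [lra|].
replace ((c' * du + dp) / (c + c') * (c + c')) with (c' * du + dp) by (field; lra).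
assert (V <= V / s * (c + c')).
{ replace V with (V / s * s) at 1 by (field; lra).
  apply Rmult_le_compat_l; [apply Rdiv_le_0_compat; lra | lra]. }
nra.
Qed.

Lemma Rmax_div_nonneg (x y : R) : 0 <= y -> 0 <= Rmax 0 x / y.
Proof.
intros [Hy | <-].
- apply Rdiv_le_0_compat; [apply Rmax_l | lra].
(* The convention [/ 0 = 0] covers two vacuum states, whose total impedance vanishes. *)
- unfold Rdiv; rewrite Rinv_0; lra.
Qed.

(** [w * (u + m)] bounds the outflow through one side of a cell, [m] being the extremal outgoing
    wave speed. The CFL condition grants half of the cell to each side. *)
Lemma half_cell_bound (tau A u w m : R) :
  0 <= tau -> tau * A <= / 2 -> m <= A -> 0 <= w ->
  tau * (w * (u + m)) <= (/ 2 + tau * u) * w.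
Proof.
intros Ht HA Hm Hw.
assert (tau * m <= / 2) by (apply Rle_trans with (tau * A); [apply Rmult_le_compat_l|]; lra).
assert (tau * m * w <= / 2 * w) by (apply Rmult_le_compat_r; lra).
lra.
Qed.

(* The velocity terms of the two interfaces cancel only in total: the reconstructed
   depths differ, so both coefficients 1/2 + tau u and 1/2 - tau u must be
   nonnegative, which is where |u| <= A is used. *)
Lemma cell_update_nonneg (tau u w wl wr fl fr : R) :
  wl <= w -> wr <= w -> tau * u <= / 2 -> - (tau * u) <= / 2 ->
  tau * fl <= (/ 2 + tau * u) * wl -> - (tau * fr) <= (/ 2 - tau * u) * wr ->
  0 <= w - tau * (fl - fr).
Proof.
intros.
assert ((/ 2 + tau * u) * wl <= (/ 2 + tau * u) * w) by (apply Rmult_le_compat_l; lra).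
assert ((/ 2 - tau * u) * wr <= (/ 2 - tau * u) * w) by (apply Rmult_le_compat_l; lra).
lra.
Qed.

Lemma contact_velocity_abs (c c' s du dp : R) :
  0 <= c -> 0 <= c' -> 0 < s <= c + c' ->
  Rabs ((c' * du + dp) / (c + c')) <= Rabs du + Rabs dp / s.
Proof.
intros Hc Hc' Hs.
assert (X : Rabs dp <= Rabs dp / s * (c + c')).
{ replace (Rabs dp) with (Rabs dp / s * s) at 1 by (field; lra).
  apply Rmult_le_compat_l; [|lra]. apply Rdiv_le_0_compat; [apply Rabs_pos | lra]. }
unfold Rdiv at 1; rewrite Rabs_mult, (Rabs_right (/ (c + c')))
  by (left; apply Rinv_0_lt_compat; lra).
apply Rmult_le_reg_r with (c + c'); [lra|].
rewrite Rmult_assoc, Rinv_l, Rmult_1_r by lra.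
apply Rle_trans with (1 := Rabs_triang _ _).
rewrite Rabs_mult, (Rabs_right c') by lra.
assert (H := Rabs_pos du). nra.
Qed.

(** Two errors are collected: freezing the weights [wl], [wr] at [w] costs [om] times a velocity
    increment, and the remainders are quadratic in the increments. What is left is
    [2 * w * (dl + dr)]. *)
Lemma expansion_error (wl wr w dl dr el er du om W a rho K d : R) :
  0 < a -> 0 <= rho -> du = dl + dr ->
  Rabs (wl - w) <= om -> Rabs (wr - w) <= om -> 0 <= wl <= W -> 0 <= wr <= W ->
  Rabs dl <= K * d -> Rabs dr <= K * d -> K * d <= rho ->
  Rabs el <= 16 / a * dl ^ 2 -> Rabs er <= 16 / a * dr ^ 2 ->
  Rabs (wl * (2 * dl + el) + wr * (2 * dr + er) - 2 * w * du)
  <= (4 * om + 32 * W * rho / a) * (K * d).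
Proof.
intros Ha Hrho -> Ol Or Wl Wr Bl Br Bk El Er.
assert (One : forall w' d' e', Rabs (w' - w) <= om -> 0 <= w' <= W -> Rabs d' <= K * d ->
  Rabs e' <= 16 / a * d' ^ 2 ->
  Rabs (2 * (w' - w) * d' + w' * e') <= (2 * om + 16 * W * rho / a) * (K * d)).
{ intros w' d' e' O0 W0 B0 E0.
  apply Rle_trans with (1 := Rabs_triang _ _); rewrite !Rabs_mult.
  rewrite (Rabs_right 2), (Rabs_right w') by lra.
  assert (X1 := Rmult_le_compat _ _ _ _ (Rabs_pos _) (Rabs_pos _) O0 B0).
  assert (A16 : 0 < 16 / a) by (apply Rdiv_lt_0_compat; lra).
  (* One factor of the square is bounded by [rho], which will be small, and the other one by
     [K * d], which gives the error its size. *)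
  assert (X2 : d' ^ 2 <= rho * (K * d)).
  { rewrite <- pow2_abs; assert (X := Rabs_pos d'). simpl; rewrite Rmult_1_r.
    apply Rmult_le_compat; lra. }
  assert (X3 : Rabs e' <= 16 / a * (rho * (K * d))).
  { apply Rle_trans with (1 := E0), Rmult_le_compat_l; lra. }
  assert (X4 := Rmult_le_compat w' W _ _ (proj1 W0) (Rabs_pos e') (proj2 W0) X3).
  replace (16 * W * rho / a * (K * d)) with (W * (16 / a * (rho * (K * d)))) by (field; lra).
  lra. }
assert (Y1 := One wl dl el Ol Wl Bl El); assert (Y2 := One wr dr er Or Wr Br Er).
replace (wl * (2 * dl + el) + wr * (2 * dr + er) - 2 * w * (dl + dr))
  with ((2 * (wl - w) * dl + wl * el) + (2 * (wr - w) * dr + wr * er)) by ring.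
apply Rle_trans with (1 := Rabs_triang _ _). lra.
Qed.

Lemma product_error (h x H X M1 e1 M2 e2 : R) :
  0 <= x <= M1 -> Rabs (h - H) <= e1 -> 0 <= H <= M2 -> Rabs (x - X) <= e2 ->
  Rabs (h * x - H * X) <= e1 * M1 + M2 * e2.
Proof.
intros Hx H1 HH H2.
replace (h * x - H * X) with ((h - H) * x + H * (x - X)) by ring.
apply Rle_trans with (1 := Rabs_triang _ _); rewrite !Rabs_mult.
rewrite (Rabs_right x), (Rabs_right H) by lra.
assert (A1 := Rabs_pos (h - H)); assert (A2 := Rabs_pos (x - X)).
apply Rplus_le_compat; apply Rmult_le_compat; lra.
Qed.

Lemma quadratic_remainder_xx (a s d : R) :
  0 < a <= s -> Rabs (d ^ 2 / s) <= 16 / a * d ^ 2.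
Proof.
intros Ha; assert (D := pow2_ge_0 d).
rewrite Rabs_right by (apply Rle_ge, Rdiv_le_0_compat; lra).
assert (/ s <= / a) by (apply Rinv_le_contravar; lra).
assert (0 < / a) by (apply Rinv_0_lt_compat; lra).
unfold Rdiv; nra.
Qed.

Lemma quadratic_remainder_zz (a s d : R) :
  0 < a <= s -> Rabs d <= a / 2 ->
  Rabs (- (d ^ 2 / s * ((3 + 2 * (d / s)) / (1 + d / s) ^ 2))) <= 16 / a * d ^ 2.
Proof.
intros Ha Hd; assert (D := pow2_ge_0 d).
assert (T : - / 2 <= d / s <= / 2).
{ apply Rabs_le_between in Hd.
  split; apply Rmult_le_reg_r with s; try lra;
    unfold Rdiv; rewrite Rmult_assoc, Rinv_l by lra; lra. }
set (t := d / s) in *.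
(* For [|t| <= 1/2] the numerator is at most 4 and the denominator at least 1/4. *)
assert (Q : 0 <= (3 + 2 * t) / (1 + t) ^ 2 <= 16).
{ assert (0 < (1 + t) ^ 2) by (apply pow_lt; lra).
  split; [apply Rdiv_le_0_compat; lra|].
  apply Rmult_le_reg_r with ((1 + t) ^ 2); [lra|].
  unfold Rdiv; rewrite Rmult_assoc, Rinv_l by lra. nra. }
assert (I : / s <= / a) by (apply Rinv_le_contravar; lra).
assert (0 < / s) by (apply Rinv_0_lt_compat; lra).
assert (0 <= d ^ 2 / s <= d ^ 2 / a).
{ split; [apply Rdiv_le_0_compat; lra | apply Rmult_le_compat_l; lra]. }
rewrite Rabs_Ropp, Rabs_right
  by (apply Rle_ge, Rmult_le_pos; lra).
replace (16 / a * d ^ 2) with (d ^ 2 / a * 16) by (field; lra).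
apply Rmult_le_compat; lra.
Qed.

Lemma pdist_components (p q : st) (d : R) : pdist p q <= d ->
  Rabs (sh p - sh q) <= d /\ Rabs (su p - su q) <= d /\
  Rabs (sxx p - sxx q) <= d /\ Rabs (szz p - szz q) <= d.
Proof.
unfold pdist; intros Hd.
assert (H1 := Rabs_pos (sh p - sh q)); assert (H2 := Rabs_pos (su p - su q)).
assert (H3 := Rabs_pos (sxx p - sxx q)); assert (H4 := Rabs_pos (szz p - szz q)).
repeat split; lra.
Qed.

Lemma pdist_triangle (p q r : st) : pdist p r <= pdist p q + pdist r q.
Proof.
unfold pdist.
assert (T : forall x y z, Rabs (x - z) <= Rabs (x - y) + Rabs (z - y)).
{ intros x y z; replace (x - z) with ((x - y) + - (z - y)) by ring.
  rewrite <- (Rabs_Ropp (z - y)); apply Rabs_triang. }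
assert (H1 := T (sh p) (sh q) (sh r)); assert (H2 := T (su p) (su q) (su r)).
assert (H3 := T (sxx p) (sxx q) (sxx r)); assert (H4 := T (szz p) (szz q) (szz r)).
lra.
Qed.

(** [d + s] is the velocity of the contact relative to the outer wave, and it is at least [a + X].
    The second conclusion equates the mass fluxes on the two sides of that wave. Only velocity
    differences enter, so both sides of the fan are covered. *)
Lemma star_depth (h a X d : R) :
  0 < h -> 0 < a -> 0 <= X -> - X <= d ->
  let s := a + 2 * X in
  let hs := / (/ h + d / (h * s)) in
  0 < hs /\ hs * (d + s) = h * s.
Proof.
intros Hh Ha HX Hd s hs; unfold hs.
assert (0 < s) by (unfold s; lra).
assert (0 < d + s) by (unfold s; lra).
replace (/ h + d / (h * s)) with ((d + s) / (h * s)) by (field; lra).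
assert (0 < h * s) by nra.
split.
- apply Rinv_0_lt_compat, Rdiv_lt_0_compat; lra.
- field; lra.
Qed.

Lemma relative_entropy_nonneg (x x0 : R) :
  0 < x -> 0 < x0 -> 0 <= x / x0 - 1 - (ln x - ln x0).
Proof.
intros Hx Hx0.
rewrite <- ln_div by lra.
assert (0 < x / x0) by (apply Rdiv_lt_0_compat; lra).
assert (H1 := exp_ineq1_le (ln (x / x0))). rewrite exp_ln in H1 by lra. lra.
Qed.

(** * Subcharacteristic condition and energy of an intermediate state *)

Section Subcharacteristic.
Variables g k : R.
Hypotheses (Hg : 0 < g) (Hk : 0 < k).

(* With r = h/hs the difference of both sides is
   (r - 1)^2/2 * (s^2 - (g hs + k sx + k sz (2/r + 1/r^2))). *)
Lemma star_energy (h a X d sx sz hs : R) :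
  0 < h -> 0 < a -> 0 <= X -> - X <= d -> 0 <= sx -> 0 <= sz ->
  a ^ 2 = g * h + k * (3 * sz + sx) ->
  0 < hs -> let s := a + 2 * X in hs * (d + s) = h * s ->
  let P := g * h ^ 2 / 2 + k * h * (sz - sx) in
  g * hs / 2 + k / 2 * (sx * (h / hs) ^ 2 + sz * (hs / h) ^ 2)
  <= g * h / 2 + k / 2 * (sx + sz)
     + ((P - h * s * d) ^ 2 - P ^ 2) / (2 * (h * s) ^ 2).
Proof.
intros Hh Ha HX Hd Hsx Hsz Ea Hhs s Es P.
assert (Hs : 0 < s) by (unfold s; lra).
assert (Ed : d = h * s / hs - s).
{ apply Rmult_eq_reg_l with hs; [|lra].
  replace (hs * (h * s / hs - s)) with (h * s - hs * s) by (field; lra). lra. }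
set (y := hs / h).
assert (Hy : 0 < y) by (apply Rdiv_lt_0_compat; lra).
assert (Ehs : hs = y * h) by (unfold y; field; lra).
assert (Hyax : y * (a + X) <= s).
{ assert (hs * (a + X) <= h * s) by (rewrite <- Es; unfold s; nra).
  unfold y. apply Rmult_le_reg_l with h; [lra|].
  replace (h * (hs / h * (a + X))) with (hs * (a + X)) by (field; lra). lra. }
(* The subcharacteristic condition. The depth ratio [y] is at most [Y = s / (a + X)], and [Y >= 1],
   so each of the three terms of [a ^ 2] grows at most by the factor [Y ^ 2], while [a * Y <= s]. *)
assert (Key : g * h * y + k * sx + k * sz * (2 * y + y ^ 2) <= s ^ 2).
{ set (Y := s / (a + X)).
  assert (HY : Y * (a + X) = s) by (unfold Y; field; lra).
  assert (HY1 : 1 <= Y).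
  { apply Rmult_le_reg_r with (a + X); [lra|]. rewrite HY; unfold s; lra. }
  assert (HyY : y <= Y).
  { apply Rmult_le_reg_r with (a + X); lra. }
  assert (HaY : a * Y <= s) by (rewrite <- HY; nra).
  assert (B1 : y <= Y ^ 2) by nra.
  assert (B2 : 2 * y + y ^ 2 <= 3 * Y ^ 2) by nra.
  assert (B3 : 1 <= Y ^ 2) by nra.
  assert (g * h * y <= g * h * Y ^ 2) by (apply Rmult_le_compat_l; nra).
  assert (k * sx * 1 <= k * sx * Y ^ 2) by (apply Rmult_le_compat_l; nra).
  assert (k * sz * (2 * y + y ^ 2) <= k * sz * (3 * Y ^ 2)) by (apply Rmult_le_compat_l; nra).
  assert ((a * Y) ^ 2 <= s ^ 2) by (apply pow_incr; split; [nra|lra]).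
  replace ((a * Y) ^ 2) with (a ^ 2 * Y ^ 2) in * by ring.
  rewrite Ea in *. lra. }
apply Rminus_le_0.
replace (_ - _) with ((/ y - 1) ^ 2 / 2
   * (s ^ 2 - (g * h * y + k * sx + k * sz * (2 * y + y ^ 2)))).
- apply Rmult_le_pos; [|lra]. assert (H := pow2_ge_0 (/ y - 1)). lra.
- rewrite Ed, Ehs. unfold P. field. lra.
Qed.

End Subcharacteristic.

(** * Three ordered waves *)

Section Waves.
Variables S1 S2 S3 : R.

Definition upwind (fl fls frs fr : R) : R :=
  if Rlt_dec 0 S1 then fl
  else if Rlt_dec 0 S2 then fls
  else if Rlt_dec 0 S3 then frs
  else fr.

Definition jumps_l (vl vls vrs vr : R) : R :=
  Rmin 0 S1 * (vls - vl) + Rmin 0 S2 * (vrs - vls) + Rmin 0 S3 * (vr - vrs).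
Definition jumps_r (vl vls vrs vr : R) : R :=
  Rmax 0 S1 * (vls - vl) + Rmax 0 S2 * (vrs - vls) + Rmax 0 S3 * (vr - vrs).

Lemma jumps_l_r (vl vls vrs vr : R) :
  jumps_l vl vls vrs vr + jumps_r vl vls vrs vr
  = S1 * (vls - vl) + S2 * (vrs - vls) + S3 * (vr - vrs).
Proof.
unfold jumps_l, jumps_r, Rmin, Rmax.
destruct (Rle_dec 0 S1), (Rle_dec 0 S2), (Rle_dec 0 S3); ring.
Qed.

Hypotheses (H12 : S1 <= S2) (H23 : S2 <= S3).

(** The hypotheses are the Rankine-Hugoniot relations. Going from the left state to the ray of speed
    zero crosses exactly the waves of negative speed, and each adds its flux jump. *)
Lemma upwind_jumps_l (fl fls frs fr vl vls vrs vr : R) :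
  S1 * (vls - vl) = fls - fl -> S2 * (vrs - vls) = frs - fls ->
  S3 * (vr - vrs) = fr - frs ->
  upwind fl fls frs fr = fl + jumps_l vl vls vrs vr.
Proof.
intros; unfold upwind, jumps_l, Rmin.
destruct (Rlt_dec 0 S1), (Rlt_dec 0 S2), (Rlt_dec 0 S3),
  (Rle_dec 0 S1), (Rle_dec 0 S2), (Rle_dec 0 S3); try lra;
  (* What remains are stationary waves: their flux jump is zero, so it does not matter on which side
     the ray is placed. *)
  repeat match goal with
  | H : ~ 0 < ?x, H' : 0 <= ?x |- _ =>
     assert (x = 0) by lra; clear H H'
  end; nra.
Qed.

(** Summation by parts: the coefficients of [vls], [vrs], [vr] are [Rmin 0 S1 - Rmin 0 S2],
    [Rmin 0 S2 - Rmin 0 S3] and [Rmin 0 S3], none of them positive because the waves are ordered. *)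
Lemma jumps_l_upper (vl vls vrs vr : R) :
  0 <= vls -> 0 <= vrs -> 0 <= vr -> jumps_l vl vls vrs vr <= - Rmin 0 S1 * vl.
Proof.
intros ? ? ?; unfold jumps_l, Rmin.
destruct (Rle_dec 0 S1), (Rle_dec 0 S2), (Rle_dec 0 S3); try lra; nra.
Qed.

Lemma jumps_r_upper (vl vls vrs vr : R) :
  0 <= vl -> 0 <= vls -> 0 <= vrs -> jumps_r vl vls vrs vr <= Rmax 0 S3 * vr.
Proof.
intros ? ? ?; unfold jumps_r, Rmax.
destruct (Rle_dec 0 S1), (Rle_dec 0 S2), (Rle_dec 0 S3); try lra; nra.
Qed.

End Waves.

(** * The relaxation solver, including vacuum *)

Definition admissible (q : st) : Prop := 0 <= sh q /\ 0 <= sxx q /\ 0 <= szz q.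

Section Scheme.
Variables g eta_p lam : R.
Hypotheses (Hg : 0 < g) (Heta : 0 < eta_p) (Hlam : 0 < lam).

Local Notation k := (eta_p / (2 * lam)).
Local Notation P q := (Pres g eta_p lam q).
Local Notation al := (sol_al g eta_p lam).
Local Notation ar := (sol_ar g eta_p lam).
Local Notation sl := (sol_sl g eta_p lam).
Local Notation sr := (sol_sr g eta_p lam).
Local Notation cl := (sol_cl g eta_p lam).
Local Notation cr := (sol_cr g eta_p lam).
Local Notation us := (sol_ustar g eta_p lam).
Local Notation ps := (sol_pistar g eta_p lam).
Local Notation hls := (sol_hls g eta_p lam).
Local Notation hrs := (sol_hrs g eta_p lam).
Local Notation S1 := (Sig1 g eta_p lam).
Local Notation S2 := (Sig2 g eta_p lam).
Local Notation S3 := (Sig3 g eta_p lam).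

Lemma k_pos : 0 < k.
Proof. apply Rdiv_lt_0_compat; lra. Qed.

Lemma dhP_nonneg (q : st) : admissible q -> 0 <= dhP g eta_p lam q.
Proof. intros (H1 & H2 & H3); assert (Hk := k_pos); unfold dhP; nra. Qed.

Lemma dhP_pos (q : st) : admissible q -> 0 < sh q -> 0 < dhP g eta_p lam q.
Proof. intros (H1 & H2 & H3) H; assert (Hk := k_pos); unfold dhP; nra. Qed.

(* Upper bounds of [u_l - u_star] and [u_star - u_r]; the speeds are [a + 2 drop]. *)
Definition drop_l (ql qr : st) : R :=
  Rmax 0 (su ql - su qr) + Rmax 0 (P qr - P ql) / (sh ql * al ql + sh qr * ar qr).
Definition drop_r (ql qr : st) : R :=
  Rmax 0 (su ql - su qr) + Rmax 0 (P ql - P qr) / (sh ql * al ql + sh qr * ar qr).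

Lemma sl_drop (ql qr : st) : sl ql qr = al ql + 2 * drop_l ql qr.
Proof. reflexivity. Qed.

Lemma sr_drop (ql qr : st) : sr ql qr = ar qr + 2 * drop_r ql qr.
Proof. reflexivity. Qed.

(** * Wave ordering and jump relations at one interface *)

Section Interface.
Variables ql qr : st.
Hypotheses (Al : admissible ql) (Ar : admissible qr).

Lemma ql_impedance_nonneg : 0 <= sh ql * al ql.
Proof. destruct Al; apply Rmult_le_pos; [lra | apply sqrt_pos]. Qed.

Lemma qr_impedance_nonneg : 0 <= sh qr * ar qr.
Proof. destruct Ar; apply Rmult_le_pos; [lra | apply sqrt_pos]. Qed.

Lemma drop_l_ge : Rmax 0 (su ql - su qr) <= drop_l ql qr.
Proof.
assert (H1 := ql_impedance_nonneg); assert (H2 := qr_impedance_nonneg).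
unfold drop_l.
assert (H := Rmax_div_nonneg (P qr - P ql) (sh ql * al ql + sh qr * ar qr)).
lra.
Qed.

Lemma drop_r_ge : Rmax 0 (su ql - su qr) <= drop_r ql qr.
Proof.
assert (H1 := ql_impedance_nonneg); assert (H2 := qr_impedance_nonneg).
unfold drop_r.
assert (H := Rmax_div_nonneg (P ql - P qr) (sh ql * al ql + sh qr * ar qr)).
lra.
Qed.

Lemma drop_l_nonneg : 0 <= drop_l ql qr.
Proof. assert (H := drop_l_ge); assert (H1 := Rmax_l 0 (su ql - su qr)); lra. Qed.

Lemma drop_r_nonneg : 0 <= drop_r ql qr.
Proof. assert (H := drop_r_ge); assert (H1 := Rmax_l 0 (su ql - su qr)); lra. Qed.

Lemma al_nonneg (q : st) : 0 <= al q.
Proof. apply sqrt_pos. Qed.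

Lemma al_pos (q : st) : admissible q -> 0 < sh q -> 0 < al q.
Proof. intros; apply sqrt_lt_R0, dhP_pos; assumption. Qed.

(* Neither needs the waves to be ordered: they also hold between two vacuum states. *)
Lemma ul_le_S3 : su ql <= S3 ql qr.
Proof.
unfold Sig3; rewrite sr_drop; assert (H := drop_r_ge); assert (H1 := al_nonneg qr).
(* The left and right sound speeds are the same function of a state. *)
change (ar qr) with (al qr).
assert (H2 := Rmax_r 0 (su ql - su qr)); assert (H3 := Rmax_l 0 (su ql - su qr)); lra.
Qed.

Lemma S1_le_ur : S1 ql qr <= su qr.
Proof.
unfold Sig1; rewrite sl_drop; assert (H := drop_l_ge); assert (H1 := al_nonneg ql).
assert (H2 := Rmax_r 0 (su ql - su qr)); assert (H3 := Rmax_l 0 (su ql - su qr)); lra.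
Qed.

(** One wet side is enough for [c_l + c_r] to be positive. Two vacuum states are treated apart, in
    [fluxes_dry]. *)
Hypothesis Hwet : 0 < sh ql + sh qr.

Lemma impedance_pos : 0 < sh ql * al ql + sh qr * ar qr.
Proof.
assert (H1 := ql_impedance_nonneg); assert (H2 := qr_impedance_nonneg).
destruct Al as [Hl _], Ar as [Hr _].
destruct (Rle_lt_or_eq_dec _ _ Hl) as [H | H].
- assert (0 < al ql) by (apply al_pos; assumption). nra.
- assert (0 < sh qr) by lra.
  assert (0 < al qr) by (apply al_pos; assumption).
  change (ar qr) with (al qr) in *. nra.
Qed.

Lemma cl_ge : sh ql * al ql <= cl ql qr.
Proof.
unfold sol_cl; rewrite sl_drop; destruct Al as [Hl _]; assert (H := drop_l_nonneg).
apply Rmult_le_compat_l; lra.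
Qed.

Lemma cr_ge : sh qr * ar qr <= cr ql qr.
Proof.
unfold sol_cr; rewrite sr_drop; destruct Ar as [Hr _]; assert (H := drop_r_nonneg).
apply Rmult_le_compat_l; lra.
Qed.

Lemma c_pos : 0 < cl ql qr + cr ql qr.
Proof. assert (H := impedance_pos); assert (H1 := cl_ge); assert (H2 := cr_ge); lra. Qed.

Lemma ustar_minus_ul :
  us ql qr - su ql
  = (cr ql qr * (su qr - su ql) + (P ql - P qr)) / (cl ql qr + cr ql qr).
Proof.
assert (H := c_pos); unfold sol_ustar, sol_Pl, sol_Pr; field; lra.
Qed.

Lemma ur_minus_ustar :
  su qr - us ql qr
  = (cl ql qr * (su qr - su ql) + (P qr - P ql)) / (cr ql qr + cl ql qr).
Proof.
assert (H := c_pos); unfold sol_ustar, sol_Pl, sol_Pr; field; lra.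
Qed.

(** The drop has [h_l a_l + h_r a_r] in its denominator and the contact velocity has [c_l + c_r],
    which is larger; this makes the explicit choice of speeds sufficient. *)
Lemma ustar_ul_drop : - drop_l ql qr <= us ql qr - su ql.
Proof.
rewrite ustar_minus_ul; unfold drop_l.
replace (su ql - su qr) with (- (su qr - su ql)) by ring.
replace (P qr - P ql) with (- (P ql - P qr)) by ring.
assert (H1 := ql_impedance_nonneg); assert (H2 := qr_impedance_nonneg).
assert (H := impedance_pos); assert (H3 := cl_ge); assert (H4 := cr_ge).
apply contact_velocity_lower; lra.
Qed.

Lemma ur_ustar_drop : - drop_r ql qr <= su qr - us ql qr.
Proof.
rewrite ur_minus_ustar; unfold drop_r.
replace (su ql - su qr) with (- (su qr - su ql)) by ring.
replace (P ql - P qr) with (- (P qr - P ql)) by ring.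
assert (H1 := ql_impedance_nonneg); assert (H2 := qr_impedance_nonneg).
assert (H := impedance_pos); assert (H3 := cl_ge); assert (H4 := cr_ge).
apply contact_velocity_lower; lra.
Qed.

Lemma momentum_jump_l : cl ql qr * (us ql qr - su ql) = P ql - ps ql qr.
Proof.
assert (H := c_pos); unfold sol_ustar, sol_pistar, sol_Pl, sol_Pr; field; lra.
Qed.

Lemma momentum_jump_r : cr ql qr * (su qr - us ql qr) = P qr - ps ql qr.
Proof.
assert (H := c_pos); unfold sol_ustar, sol_pistar, sol_Pl, sol_Pr; field; lra.
Qed.

Lemma S1_le_ustar : S1 ql qr <= us ql qr.
Proof.
assert (H := ustar_ul_drop); assert (H1 := drop_l_nonneg); assert (H2 := al_nonneg ql).
unfold Sig1; rewrite sl_drop; lra.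
Qed.

Lemma ustar_le_S3 : us ql qr <= S3 ql qr.
Proof.
assert (H := ur_ustar_drop); assert (H1 := drop_r_nonneg); assert (H2 := al_nonneg qr).
unfold Sig3; rewrite sr_drop; change (ar qr) with (al qr); lra.
Qed.

Lemma hls_pos : 0 < sh ql -> 0 < hls ql qr.
Proof.
intros Hl. assert (H := ustar_ul_drop).
unfold sol_hls; destruct (Rle_dec (sh ql) 0); [lra|].
assert (Hc := c_pos).
assert (Hcl : 0 < cl ql qr).
{ assert (H1 := cl_ge); assert (0 < al ql) by (apply al_pos; assumption). nra. }
destruct (star_depth (sh ql) (al ql) (drop_l ql qr) (us ql qr - su ql)) as [H1 _];
  auto using drop_l_nonneg, al_pos.
change (sh ql * (al ql + 2 * drop_l ql qr)) with (cl ql qr) in H1.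
rewrite ustar_minus_ul in H1.
match goal with |- 0 < / (_ + ?x) =>
  match type of H1 with 0 < / (_ + ?y) => replace x with y; [exact H1|] end end.
unfold sol_Pl, sol_Pr; field; lra.
Qed.

(** Conservation of mass across the outer wave: by definition of [S1], the flux
    [sh ql * (su ql - S1)] on the other side is [cl] too. On a vacuum side both vanish. *)
Lemma mass_jump_l : hls ql qr * (us ql qr - S1 ql qr) = cl ql qr.
Proof.
assert (H := ustar_ul_drop).
unfold sol_hls; destruct (Rle_dec (sh ql) 0) as [Hl|Hl].
{ destruct Al as [H0 _]; unfold sol_cl; replace (sh ql) with 0 by lra; ring. }
apply Rnot_le_lt in Hl.
assert (Hc := c_pos).
assert (Hcl : 0 < cl ql qr).
{ assert (H1 := cl_ge); assert (0 < al ql) by (apply al_pos; assumption). nra. }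
destruct (star_depth (sh ql) (al ql) (drop_l ql qr) (us ql qr - su ql)) as [_ H1];
  auto using drop_l_nonneg, al_pos.
change (sh ql * (al ql + 2 * drop_l ql qr)) with (cl ql qr) in H1.
replace (us ql qr - S1 ql qr) with (us ql qr - su ql + (al ql + 2 * drop_l ql qr))
  by (unfold Sig1; rewrite sl_drop; ring).
rewrite <- H1 at 3.
f_equal. f_equal. f_equal.
rewrite ustar_minus_ul; unfold sol_Pl, sol_Pr; field; lra.
Qed.

Lemma hrs_pos : 0 < sh qr -> 0 < hrs ql qr.
Proof.
intros Hl. assert (H := ur_ustar_drop).
unfold sol_hrs; destruct (Rle_dec (sh qr) 0); [lra|].
assert (Hc := c_pos).
assert (Hcl : 0 < cr ql qr).
{ assert (H1 := cr_ge); assert (0 < ar qr) by (apply al_pos; assumption). nra. }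
destruct (star_depth (sh qr) (ar qr) (drop_r ql qr) (su qr - us ql qr)) as [H1 _];
  auto using drop_r_nonneg.
{ apply al_pos; assumption. }
change (sh qr * (ar qr + 2 * drop_r ql qr)) with (cr ql qr) in H1.
rewrite ur_minus_ustar in H1.
match goal with |- 0 < / (_ + ?x) =>
  match type of H1 with 0 < / (_ + ?y) => replace x with y; [exact H1|] end end.
unfold sol_Pl, sol_Pr; field; lra.
Qed.

Lemma mass_jump_r : hrs ql qr * (S3 ql qr - us ql qr) = cr ql qr.
Proof.
assert (H := ur_ustar_drop).
unfold sol_hrs; destruct (Rle_dec (sh qr) 0) as [Hl|Hl].
{ destruct Ar as [H0 _]; unfold sol_cr; replace (sh qr) with 0 by lra; ring. }
apply Rnot_le_lt in Hl.
assert (Hc := c_pos).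
assert (Hcl : 0 < cr ql qr).
{ assert (H1 := cr_ge); assert (0 < ar qr) by (apply al_pos; assumption). nra. }
destruct (star_depth (sh qr) (ar qr) (drop_r ql qr) (su qr - us ql qr)) as [_ H1];
  auto using drop_r_nonneg.
{ apply al_pos; assumption. }
change (sh qr * (ar qr + 2 * drop_r ql qr)) with (cr ql qr) in H1.
replace (S3 ql qr - us ql qr) with (su qr - us ql qr + (ar qr + 2 * drop_r ql qr))
  by (unfold Sig3; rewrite sr_drop; ring).
rewrite <- H1 at 3.
f_equal. f_equal. f_equal.
rewrite ur_minus_ustar; unfold sol_Pl, sol_Pr; field; lra.
Qed.

Lemma hls_nonneg : 0 <= hls ql qr.
Proof.
destruct Al as [[H | H] _]; [left; apply hls_pos; assumption|].
unfold sol_hls; destruct (Rle_dec (sh ql) 0); lra.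
Qed.

Lemma hrs_nonneg : 0 <= hrs ql qr.
Proof.
destruct Ar as [[H | H] _]; [left; apply hrs_pos; assumption|].
unfold sol_hrs; destruct (Rle_dec (sh qr) 0); lra.
Qed.

Lemma flux_h_jumps_l :
  flux_h g eta_p lam ql qr
  = sh ql * su ql + jumps_l (S1 ql qr) (S2 ql qr) (S3 ql qr)
      (sh ql) (hls ql qr) (hrs ql qr) (sh qr).
Proof.
rewrite <- (upwind_jumps_l _ _ _) with (fls := hls ql qr * us ql qr)
   (frs := hrs ql qr * us ql qr) (fr := sh qr * su qr).
- unfold flux_h, at0, upwind.
  repeat destruct (Rlt_dec _ _); reflexivity.
- apply S1_le_ustar.
- apply ustar_le_S3.
- assert (H := mass_jump_l); revert H; unfold Sig1, sol_cl; lra.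
- unfold Sig2; ring.
- assert (H := mass_jump_r); revert H; unfold Sig3, sol_cr; lra.
Qed.

Lemma flux_hu_jumps_l :
  flux_hu g eta_p lam ql qr
  = sh ql * su ql ^ 2 + P ql + jumps_l (S1 ql qr) (S2 ql qr) (S3 ql qr)
      (sh ql * su ql) (hls ql qr * us ql qr) (hrs ql qr * us ql qr) (sh qr * su qr).
Proof.
rewrite <- (upwind_jumps_l _ _ _) with (fls := hls ql qr * us ql qr ^ 2 + ps ql qr)
   (frs := hrs ql qr * us ql qr ^ 2 + ps ql qr) (fr := sh qr * su qr ^ 2 + P qr).
- unfold flux_hu, at0, upwind.
  repeat destruct (Rlt_dec _ _); reflexivity.
- apply S1_le_ustar.
- apply ustar_le_S3.
- assert (H := mass_jump_l); assert (H1 := momentum_jump_l).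
  assert (E : sh ql * (su ql - S1 ql qr) = cl ql qr) by (unfold Sig1, sol_cl; ring).
  (* Multiplying the two mass fluxes by their velocities supplies the products that make the
     momentum relation linear. *)
  assert (X1 := f_equal (Rmult (us ql qr)) H).
  assert (X2 := f_equal (Rmult (su ql)) E). lra.
- unfold Sig2; ring.
- assert (H := mass_jump_r); assert (H1 := momentum_jump_r).
  assert (E : sh qr * (S3 ql qr - su qr) = cr ql qr) by (unfold Sig3, sol_cr; ring).
  assert (X1 := f_equal (Rmult (us ql qr)) H).
  assert (X2 := f_equal (Rmult (su qr)) E). lra.
Qed.

End Interface.

(** * Energy inequality without topography *)

Lemma mass_balance (ql qr : st) (Al : admissible ql) (Ar : admissible qr)
  (Hwet : 0 < sh ql + sh qr) :
  S1 ql qr * (hls ql qr - sh ql) + S2 ql qr * (hrs ql qr - hls ql qr)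
  + S3 ql qr * (sh qr - hrs ql qr) = sh qr * su qr - sh ql * su ql.
Proof.
assert (H1 := mass_jump_l ql qr Al Ar Hwet); assert (H2 := mass_jump_r ql qr Al Ar Hwet).
revert H1 H2; unfold sol_cl, sol_cr, Sig1, Sig2, Sig3; lra.
Qed.

Lemma momentum_balance (ql qr : st) (Al : admissible ql) (Ar : admissible qr)
  (Hwet : 0 < sh ql + sh qr) :
  S1 ql qr * (hls ql qr * us ql qr - sh ql * su ql)
  + S2 ql qr * (hrs ql qr * us ql qr - hls ql qr * us ql qr)
  + S3 ql qr * (sh qr * su qr - hrs ql qr * us ql qr)
  = sh qr * su qr ^ 2 + P qr - (sh ql * su ql ^ 2 + P ql).
Proof.
assert (H1 := f_equal (Rmult (us ql qr)) (mass_jump_l ql qr Al Ar Hwet)).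
assert (H2 := f_equal (Rmult (us ql qr)) (mass_jump_r ql qr Al Ar Hwet)).
assert (H3 := momentum_jump_l ql qr Al Ar Hwet).
assert (H4 := momentum_jump_r ql qr Al Ar Hwet).
revert H1 H2 H3 H4; unfold sol_cl, sol_cr, Sig1, Sig2, Sig3; lra.
Qed.

(** The balance over the whole fan converts the expansion from the left into one from the right,
    since [Rmin 0 S + Rmax 0 S = S]. *)
Lemma flux_h_jumps_r (ql qr : st) (Al : admissible ql) (Ar : admissible qr)
  (Hwet : 0 < sh ql + sh qr) :
  flux_h g eta_p lam ql qr
  = sh qr * su qr - jumps_r (S1 ql qr) (S2 ql qr) (S3 ql qr)
      (sh ql) (hls ql qr) (hrs ql qr) (sh qr).
Proof.
rewrite flux_h_jumps_l by assumption.
assert (H := mass_balance ql qr Al Ar Hwet).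
rewrite <- jumps_l_r in H; lra.
Qed.

Lemma flux_hu_jumps_r (ql qr : st) (Al : admissible ql) (Ar : admissible qr)
  (Hwet : 0 < sh ql + sh qr) :
  flux_hu g eta_p lam ql qr
  = sh qr * su qr ^ 2 + P qr - jumps_r (S1 ql qr) (S2 ql qr) (S3 ql qr)
      (sh ql * su ql) (hls ql qr * us ql qr) (hrs ql qr * us ql qr) (sh qr * su qr).
Proof.
rewrite flux_hu_jumps_l by assumption.
assert (H := momentum_balance ql qr Al Ar Hwet).
rewrite <- jumps_l_r in H; lra.
Qed.

Definition specific_energy (q : st) : R :=
  g * sh q / 2 + k / 2 * (sxx q + szz q - ln (sxx q * szz q) - 2).

Definition energy (q : st) : R := sh q * (su q ^ 2 / 2 + specific_energy q).

(* Energies carried by the relaxation system in the intermediate states; they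
   bound from above the energies of q_l^*, q_r^*. *)
Definition relaxed_energy_l (ql qr : st) : R :=
  hls ql qr * (us ql qr ^ 2 / 2 + specific_energy ql
               + (ps ql qr ^ 2 - P ql ^ 2) / (2 * cl ql qr ^ 2)).
Definition relaxed_energy_r (ql qr : st) : R :=
  hrs ql qr * (us ql qr ^ 2 / 2 + specific_energy qr
               + (ps ql qr ^ 2 - P qr ^ 2) / (2 * cr ql qr ^ 2)).

(* The differential of E at q. Since its h-component contains ln(sigma_xx sigma_zz)
   but no 1/h, it makes sense in vacuum. *)
Definition dE (q : st) (v : v4) : R :=
  (- su q ^ 2 / 2 + g * sh q - k / 2 * ln (sxx q * szz q)) * c1 v
  + su q * c2 v + k / 2 * (1 - / sxx q) * c3 v + k / 2 * (1 - / szz q) * c4 v.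

(** Vacuum is kept because a reconstructed state may be dry; positive stresses give the logarithm a
    meaning. *)
Definition stressed (q : st) : Prop := 0 <= sh q /\ 0 < sxx q /\ 0 < szz q.

Lemma stressed_admissible (q : st) : stressed q -> admissible q.
Proof. intros (? & ? & ?); repeat split; lra. Qed.

(* Legendre: E(q0) - dE(q0) q0 = - g h0^2/2, so this is convexity of E. *)
Lemma energy_convex (q0 q : st) :
  stressed q0 -> stressed q -> 0 <= energy q - dE q0 (cons q) + g * sh q0 ^ 2 / 2.
Proof.
destruct q0 as [h0 u0 x0 z0], q as [h u x z].
intros (Hh0 & Hx0 & Hz0) (Hh & Hx & Hz); assert (Hk := k_pos); simpl in *.
unfold energy, specific_energy, dE; cbn [sh su sxx szz cons c1 c2 c3 c4].
rewrite !ln_mult by assumption.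
assert (Rx := relative_entropy_nonneg x x0 Hx Hx0).
assert (Rz := relative_entropy_nonneg z z0 Hz Hz0).
match goal with |- 0 <= ?e =>
  replace e with (h * (u - u0) ^ 2 / 2 + g * (h - h0) ^ 2 / 2
    + k / 2 * h * ((x / x0 - 1 - (ln x - ln x0)) + (z / z0 - 1 - (ln z - ln z0))))
  by (field; lra) end.
assert (0 <= (u - u0) ^ 2) by apply pow2_ge_0.
assert (0 <= (h - h0) ^ 2) by apply pow2_ge_0.
assert (0 <= h * (u - u0) ^ 2) by (apply Rmult_le_pos; lra).
assert (0 <= g * (h - h0) ^ 2) by (apply Rmult_le_pos; lra).
assert (0 <= k / 2 * h * ((x / x0 - 1 - (ln x - ln x0)) + (z / z0 - 1 - (ln z - ln z0)))).
{ apply Rmult_le_pos; [apply Rmult_le_pos; lra | lra]. }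
lra.
Qed.

Lemma al_square (q : st) : admissible q -> al q ^ 2 = g * sh q + k * (3 * szz q + sxx q).
Proof. intros H; unfold sol_al; rewrite pow2_sqrt; [reflexivity | apply dhP_nonneg, H]. Qed.

(** The relaxed energy dominates the true energy of the intermediate state by [star_energy], and the
    latter lies above its tangent at [q0] by convexity. *)
Lemma relaxed_energy_l_convex (q0 ql qr : st) :
  stressed q0 -> stressed ql -> admissible qr -> 0 < sh ql + sh qr ->
  0 <= relaxed_energy_l ql qr - dE q0 (sol_qls g eta_p lam ql qr) + g * sh q0 ^ 2 / 2.
Proof.
intros H0 Hl Ar Hwet; assert (Al := stressed_admissible _ Hl).
destruct (Hl) as ([Hh | Hh] & Hx & Hz).
(* On a vacuum side the intermediate state is zero and only [g * sh q0 ^ 2 / 2] survives. *)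
2:{ unfold relaxed_energy_l, dE, sol_qls; cbn [c1 c2 c3 c4]; unfold sol_hls.
    destruct (Rle_dec (sh ql) 0); [|lra].
    destruct H0 as [H0 _]. assert (0 <= sh q0 ^ 2) by apply pow2_ge_0. nra. }
assert (Hs := hls_pos ql qr Al Ar Hwet Hh).
set (q := mkst (hls ql qr) (us ql qr) (sol_sxxls g eta_p lam ql qr) (sol_szzls g eta_p lam ql qr)).
assert (Hr : 0 < (sh ql / hls ql qr) ^ 2) by (apply pow_lt, Rdiv_lt_0_compat; lra).
assert (Hr' : 0 < (hls ql qr / sh ql) ^ 2) by (apply pow_lt, Rdiv_lt_0_compat; lra).
assert (Hq : stressed q).
{ split; [simpl; lra | split; simpl; unfold sol_sxxls, sol_szzls; apply Rmult_lt_0_compat; lra]. }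
assert (C := energy_convex q0 q H0 Hq).
change (cons q) with (sol_qls g eta_p lam ql qr) in C.
enough (energy q <= relaxed_energy_l ql qr) by lra.
unfold energy, relaxed_energy_l, specific_energy; simpl sh; simpl su; simpl sxx; simpl szz.
apply Rmult_le_compat_l; [lra|].
assert (D := ustar_ul_drop ql qr Al Ar Hwet).
assert (Hd := drop_l_nonneg ql qr Al Ar).
assert (Es := star_energy g k Hg k_pos (sh ql) (al ql) (drop_l ql qr) (us ql qr - su ql)
  (sxx ql) (szz ql) (hls ql qr) Hh (al_pos ql Al Hh) Hd D (Rlt_le _ _ Hx) (Rlt_le _ _ Hz)
  (al_square ql Al) Hs).
cbv zeta in Es; rewrite <- sl_drop in Es.
assert (E1 : hls ql qr * (us ql qr - su ql + sl ql qr) = sh ql * sl ql qr).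
{ change (sh ql * sl ql qr) with (cl ql qr). rewrite <- mass_jump_l by assumption.
  unfold Sig1; ring. }
specialize (Es E1); clear E1.
change (sh ql * sl ql qr) with (cl ql qr) in Es.
change (g * sh ql ^ 2 / 2 + k * sh ql * (szz ql - sxx ql)) with (P ql) in Es.
rewrite momentum_jump_l in Es by assumption.
replace (P ql - (P ql - ps ql qr)) with (ps ql qr) in Es by ring.
unfold sol_sxxls, sol_szzls.
(* The product of the two stresses is unchanged across the wave, so the logarithms cancel. *)
replace (sxx ql * (sh ql / hls ql qr) ^ 2 * (szz ql * (hls ql qr / sh ql) ^ 2))
  with (sxx ql * szz ql) by (field; lra).
lra.
Qed.

Lemma relaxed_energy_r_convex (q0 ql qr : st) :
  stressed q0 -> admissible ql -> stressed qr -> 0 < sh ql + sh qr ->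
  0 <= relaxed_energy_r ql qr - dE q0 (sol_qrs g eta_p lam ql qr) + g * sh q0 ^ 2 / 2.
Proof.
intros H0 Al Hl Hwet; assert (Ar := stressed_admissible _ Hl).
destruct (Hl) as ([Hh | Hh] & Hx & Hz).
2:{ unfold relaxed_energy_r, dE, sol_qrs; cbn [c1 c2 c3 c4]; unfold sol_hrs.
    destruct (Rle_dec (sh qr) 0); [|lra].
    destruct H0 as [H0 _]. assert (0 <= sh q0 ^ 2) by apply pow2_ge_0. nra. }
assert (Hs := hrs_pos ql qr Al Ar Hwet Hh).
set (q := mkst (hrs ql qr) (us ql qr) (sol_sxxrs g eta_p lam ql qr) (sol_szzrs g eta_p lam ql qr)).
assert (Hr : 0 < (sh qr / hrs ql qr) ^ 2) by (apply pow_lt, Rdiv_lt_0_compat; lra).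
assert (Hr' : 0 < (hrs ql qr / sh qr) ^ 2) by (apply pow_lt, Rdiv_lt_0_compat; lra).
assert (Hq : stressed q).
{ split; [simpl; lra | split; simpl; unfold sol_sxxrs, sol_szzrs; apply Rmult_lt_0_compat; lra]. }
assert (C := energy_convex q0 q H0 Hq).
change (cons q) with (sol_qrs g eta_p lam ql qr) in C.
enough (energy q <= relaxed_energy_r ql qr) by lra.
unfold energy, relaxed_energy_r, specific_energy; simpl sh; simpl su; simpl sxx; simpl szz.
apply Rmult_le_compat_l; [lra|].
assert (D := ur_ustar_drop ql qr Al Ar Hwet).
assert (Hd := drop_r_nonneg ql qr Al Ar).
assert (Es := star_energy g k Hg k_pos (sh qr) (ar qr) (drop_r ql qr) (su qr - us ql qr)
  (sxx qr) (szz qr) (hrs ql qr) Hh (al_pos qr Ar Hh) Hd D (Rlt_le _ _ Hx) (Rlt_le _ _ Hz)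
  (al_square qr Ar) Hs).
cbv zeta in Es; rewrite <- sr_drop in Es.
assert (E1 : hrs ql qr * (su qr - us ql qr + sr ql qr) = sh qr * sr ql qr).
{ change (sh qr * sr ql qr) with (cr ql qr). rewrite <- mass_jump_r by assumption.
  unfold Sig3; ring. }
specialize (Es E1); clear E1.
change (sh qr * sr ql qr) with (cr ql qr) in Es.
change (g * sh qr ^ 2 / 2 + k * sh qr * (szz qr - sxx qr)) with (P qr) in Es.
rewrite momentum_jump_r in Es by assumption.
replace (P qr - (P qr - ps ql qr)) with (ps ql qr) in Es by ring.
unfold sol_sxxrs, sol_szzrs.
replace (sxx qr * (sh qr / hrs ql qr) ^ 2 * (szz qr * (hrs ql qr / sh qr) ^ 2))
  with (sxx qr * szz qr) by (field; lra).
lra.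
Qed.

(** The relaxed energy obeys an exact jump relation with the relaxed pressure. This is what lets the
    energies telescope over the fan, which the true energies of the intermediate states need not
    do. *)
Lemma energy_jump_l (ql qr : st) (Al : admissible ql) (Ar : admissible qr)
  (Hwet : 0 < sh ql + sh qr) :
  S1 ql qr * (relaxed_energy_l ql qr - energy ql)
  = (relaxed_energy_l ql qr + ps ql qr) * us ql qr - (energy ql + P ql) * su ql.
Proof.
assert (M := mass_jump_l ql qr Al Ar Hwet).
assert (Q := momentum_jump_l ql qr Al Ar Hwet).
destruct (Al) as ([Hh | Hh] & _).
- assert (Hc : 0 < cl ql qr).
  { assert (H1 := cl_ge ql qr Al Ar); assert (H2 := al_pos ql Al Hh). nra. }
  assert (E : ps ql qr = P ql - cl ql qr * (us ql qr - su ql)) by lra.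
  assert (Ml : sh ql * (su ql - S1 ql qr) = cl ql qr) by (unfold Sig1, sol_cl; ring).
  set (a := us ql qr ^ 2 / 2 + specific_energy ql
               + (ps ql qr ^ 2 - P ql ^ 2) / (2 * cl ql qr ^ 2)).
  set (b := su ql ^ 2 / 2 + specific_energy ql).
  change (relaxed_energy_l ql qr) with (hls ql qr * a).
  change (energy ql) with (sh ql * b).
  assert (X1 := f_equal (Rmult a) M); assert (X2 := f_equal (Rmult b) Ml).
  enough (a * cl ql qr - b * cl ql qr = P ql * su ql - ps ql qr * us ql qr) by lra.
  unfold a, b; rewrite E; field; lra.
- assert (Hc : cl ql qr = 0) by (unfold sol_cl; rewrite <- Hh; ring).
  assert (HP : P ql = 0) by (unfold Pres; rewrite <- Hh; field; lra).
  assert (Hs : hls ql qr = 0) by (unfold sol_hls; destruct (Rle_dec _ _); lra).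
  (* With no impedance on the vacuum side, the momentum relation forces [ps] to vanish. *)
  rewrite Hc, HP in Q.
  unfold relaxed_energy_l, energy; rewrite HP, Hs, <- Hh.
  replace (ps ql qr) with 0 by lra; ring.
Qed.

Lemma energy_jump_r (ql qr : st) (Al : admissible ql) (Ar : admissible qr)
  (Hwet : 0 < sh ql + sh qr) :
  S3 ql qr * (energy qr - relaxed_energy_r ql qr)
  = (energy qr + P qr) * su qr - (relaxed_energy_r ql qr + ps ql qr) * us ql qr.
Proof.
assert (M := mass_jump_r ql qr Al Ar Hwet).
assert (Q := momentum_jump_r ql qr Al Ar Hwet).
destruct (Ar) as ([Hh | Hh] & _).
- assert (Hc : 0 < cr ql qr).
  { assert (H1 := cr_ge ql qr Al Ar); assert (H2 := al_pos qr Ar Hh).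
    change (ar qr) with (al qr) in *. nra. }
  assert (E : ps ql qr = P qr - cr ql qr * (su qr - us ql qr)) by lra.
  assert (Ml : sh qr * (S3 ql qr - su qr) = cr ql qr) by (unfold Sig3, sol_cr; ring).
  set (a := us ql qr ^ 2 / 2 + specific_energy qr
               + (ps ql qr ^ 2 - P qr ^ 2) / (2 * cr ql qr ^ 2)).
  set (b := su qr ^ 2 / 2 + specific_energy qr).
  change (relaxed_energy_r ql qr) with (hrs ql qr * a).
  change (energy qr) with (sh qr * b).
  assert (X1 := f_equal (Rmult a) M); assert (X2 := f_equal (Rmult b) Ml).
  enough (b * cr ql qr - a * cr ql qr = P qr * su qr - ps ql qr * us ql qr) by lra.
  unfold a, b; rewrite E; field; lra.
- assert (Hc : cr ql qr = 0) by (unfold sol_cr; rewrite <- Hh; ring).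
  assert (HP : P qr = 0) by (unfold Pres; rewrite <- Hh; field; lra).
  assert (Hs : hrs ql qr = 0) by (unfold sol_hrs; destruct (Rle_dec _ _); lra).
  rewrite Hc, HP in Q.
  unfold relaxed_energy_r, energy; rewrite HP, Hs, <- Hh.
  replace (ps ql qr) with 0 by lra; ring.
Qed.

(** The flux is [u] times the conserved vector plus the pressure in the momentum slot. Every term of
    the energy but [g h^2/2] is homogeneous of degree one, so Euler's identity produces exactly this
    correction. *)
Lemma energy_flux_legendre (q : st) : stressed q ->
  dE q (Flux g eta_p lam q) - g * sh q ^ 2 / 2 * su q = (energy q + P q) * su q.
Proof.
intros (_ & Hx & Hz).
unfold dE, energy, specific_energy, Flux, Pres; cbn [c1 c2 c3 c4]; field; lra.
Qed.

Lemma energy_legendre (q : st) : stressed q ->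
  energy q - dE q (cons q) + g * sh q ^ 2 / 2 = 0.
Proof.
intros (_ & Hx & Hz).
unfold dE, energy, specific_energy, cons; cbn [c1 c2 c3 c4]; field; lra.
Qed.

Lemma homogeneous_energy_inequality (ql qr : st) :
  stressed ql -> stressed qr -> 0 < sh ql + sh qr ->
  dE qr (solFr g eta_p lam ql qr) - g * sh qr ^ 2 / 2 * su qr
  <= dE ql (solFl g eta_p lam ql qr) - g * sh ql ^ 2 / 2 * su ql.
Proof.
intros Hl Hr Hwet.
assert (Al := stressed_admissible _ Hl); assert (Ar := stressed_admissible _ Hr).
(* Excess of an energy [e] over the tangent at [q0]. The flux jumps are linear in the states, so
   adding and subtracting energies splits each bound into energy jumps and jumps of [D]. *)
set (D := fun q0 e v => e - dE q0 v + g * sh q0 ^ 2 / 2).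
set (s1 := S1 ql qr); set (s2 := S2 ql qr); set (s3 := S3 ql qr).
set (vl := sol_qls g eta_p lam ql qr); set (vr := sol_qrs g eta_p lam ql qr).
set (el := relaxed_energy_l ql qr); set (er := relaxed_energy_r ql qr).
assert (L : dE ql (solFl g eta_p lam ql qr) - g * sh ql ^ 2 / 2 * su ql
  = (energy ql + P ql) * su ql + jumps_l s1 s2 s3 (energy ql) el er (energy qr)
    - jumps_l s1 s2 s3 (D ql (energy ql) (cons ql)) (D ql el vl) (D ql er vr)
        (D ql (energy qr) (cons qr))).
{ rewrite <- energy_flux_legendre by assumption.
  unfold solFl; rewrite flux_h_jumps_l, flux_hu_jumps_l by assumption.
  unfold D, dE, flux_wl, jumps_l, vl, vr, s1, s2, s3.
  cbn [c1 c2 c3 c4 Flux cons sol_qls sol_qrs]. ring. }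
assert (R : dE qr (solFr g eta_p lam ql qr) - g * sh qr ^ 2 / 2 * su qr
  = (energy qr + P qr) * su qr - jumps_r s1 s2 s3 (energy ql) el er (energy qr)
    + jumps_r s1 s2 s3 (D qr (energy ql) (cons ql)) (D qr el vl) (D qr er vr)
        (D qr (energy qr) (cons qr))).
{ rewrite <- energy_flux_legendre by assumption.
  unfold solFr; rewrite flux_h_jumps_r, flux_hu_jumps_r by assumption.
  unfold D, dE, flux_wr, jumps_r, vl, vr, s1, s2, s3.
  cbn [c1 c2 c3 c4 Flux cons sol_qls sol_qrs]. ring. }
(* By the energy jump relations the left and right energy expansions have one common value, an
   energy flux that separates the two bounds; the jumps of [D] have the right signs. *)
assert (B := jumps_l_r s1 s2 s3 (energy ql) el er (energy qr)).
assert (J1 := energy_jump_l ql qr Al Ar Hwet).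
assert (J3 := energy_jump_r ql qr Al Ar Hwet).
assert (J2 : s2 * (er - el) = (er + ps ql qr) * us ql qr - (el + ps ql qr) * us ql qr)
  by (unfold s2, Sig2; ring).
fold s1 s3 el er in J1, J3.
assert (O1 := S1_le_ustar ql qr Al Ar Hwet : s1 <= s2).
assert (O2 := ustar_le_S3 ql qr Al Ar Hwet : s2 <= s3).
assert (Nl := jumps_l_upper s1 s2 s3 O1 O2 (D ql (energy ql) (cons ql)) (D ql el vl)
  (D ql er vr) (D ql (energy qr) (cons qr))
  (relaxed_energy_l_convex ql ql qr Hl Hl Ar Hwet)
  (relaxed_energy_r_convex ql ql qr Hl Al Hr Hwet)
  (energy_convex ql qr Hl Hr)).
assert (Nr := jumps_r_upper s1 s2 s3 O1 O2 (D qr (energy ql) (cons ql)) (D qr el vl)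
  (D qr er vr) (D qr (energy qr) (cons qr))
  (energy_convex qr ql Hr Hl)
  (relaxed_energy_l_convex qr ql qr Hr Hl Ar Hwet)
  (relaxed_energy_r_convex qr ql qr Hr Al Hr Hwet)).
assert (Zl : D ql (energy ql) (cons ql) = 0) by (apply energy_legendre; assumption).
assert (Zr : D qr (energy qr) (cons qr) = 0) by (apply energy_legendre; assumption).
rewrite Zl in *; rewrite Zr in *. lra.
Qed.

(** * Dry and equal states, positivity *)

Lemma sol_hls_dry (ql qr : st) : sh ql = 0 -> hls ql qr = 0.
Proof. intros H; unfold sol_hls; destruct (Rle_dec _ _); lra. Qed.

Lemma sol_hrs_dry (ql qr : st) : sh qr = 0 -> hrs ql qr = 0.
Proof. intros H; unfold sol_hrs; destruct (Rle_dec _ _); lra. Qed.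

Lemma Pres_dry (q : st) : sh q = 0 -> P q = 0.
Proof. intros H; unfold Pres; rewrite H; field; lra. Qed.

Lemma fluxes_dry (ql qr : st) : sh ql = 0 -> sh qr = 0 ->
  solFl g eta_p lam ql qr = mkv4 0 0 0 0 /\ solFr g eta_p lam ql qr = mkv4 0 0 0 0.
Proof.
intros Hl Hr.
assert (Es := sol_hls_dry ql qr Hl); assert (Er := sol_hrs_dry ql qr Hr).
assert (Pl := Pres_dry ql Hl); assert (Pr := Pres_dry qr Hr).
(* A quotient of zero by zero; the vanishing numerator settles it. *)
assert (Ep : ps ql qr = 0).
{ unfold sol_pistar, sol_cl, sol_cr, sol_Pl, sol_Pr; rewrite Pl, Pr, Hl, Hr.
  unfold Rdiv; ring. }
assert (Fh : flux_h g eta_p lam ql qr = 0).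
{ unfold flux_h, at0; rewrite Es, Er, Hl, Hr.
  repeat destruct (Rlt_dec _ _); ring. }
assert (Fhu : flux_hu g eta_p lam ql qr = 0).
{ unfold flux_hu, at0; rewrite Es, Er, Hl, Hr, Ep; unfold sol_Pl, sol_Pr; rewrite Pl, Pr.
  repeat destruct (Rlt_dec _ _); ring. }
unfold solFl, solFr; rewrite Fh, Fhu.
unfold flux_wl, flux_wr; cbn [c1 c2 c3 c4 Flux cons sol_qls sol_qrs].
rewrite Es, Er, Hl, Hr; split; f_equal; ring.
Qed.

(** Equal data make the contact velocity equal to [su q] and collapse both intermediate states onto
    [q], so no jump remains. Consistency and well-balancing both rest on this. *)
Lemma fluxes_diag (q : st) : stressed q ->
  solFl g eta_p lam q q = Flux g eta_p lam q /\ solFr g eta_p lam q q = Flux g eta_p lam q.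
Proof.
intros Hq; assert (Aq := stressed_admissible q Hq).
destruct Hq as ([Hh | Hh] & Hx & Hz).
2:{ destruct (fluxes_dry q q) as [-> ->]; auto.
    assert (Hp := Pres_dry q (eq_sym Hh)).
    unfold Flux; rewrite Hp, <- Hh; split; f_equal; ring. }
assert (Hwet : 0 < sh q + sh q) by lra.
assert (C := c_pos q q Aq Aq Hwet).
assert (Eu : us q q = su q).
{ assert (E := ustar_minus_ul q q Aq Aq Hwet).
  replace (cr q q * (su q - su q) + (P q - P q)) with 0 in E by ring.
  unfold Rdiv in E; rewrite Rmult_0_l in E; lra. }
assert (Ml := mass_jump_l q q Aq Aq Hwet); assert (Mr := mass_jump_r q q Aq Aq Hwet).
unfold Sig1, sol_cl in Ml; unfold Sig3, sol_cr in Mr; rewrite Eu in Ml, Mr.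
assert (Ha := al_pos q Aq Hh).
assert (Hl : 0 < sl q q) by (rewrite sl_drop; assert (H := drop_l_nonneg q q Aq Aq); lra).
assert (Hr : 0 < sr q q).
{ rewrite sr_drop; assert (H := drop_r_nonneg q q Aq Aq). change (ar q) with (al q); lra. }
assert (El : hls q q = sh q) by (apply Rmult_eq_reg_r with (sl q q); lra).
assert (Er : hrs q q = sh q) by (apply Rmult_eq_reg_r with (sr q q); lra).
assert (E1 : sh q / sh q = 1) by (field; lra).
split; unfold solFl, solFr, Flux; rewrite flux_h_jumps_l, flux_hu_jumps_l by assumption;
  unfold jumps_l, flux_wl, flux_wr; cbn [c1 c2 c3 c4 Flux cons sol_qls sol_qrs];
  unfold sol_sxxls, sol_sxxrs, sol_szzls, sol_szzrs;
  rewrite El, Er, Eu, E1; f_equal; ring.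
Qed.

(** Summation by parts for the depth. Besides positivity, it shows that mass can only enter a dry
    left state, which the topography term needs. *)
Lemma flux_h_upper (ql qr : st) : admissible ql -> admissible qr ->
  flux_h g eta_p lam ql qr <= sh ql * (su ql - Rmin 0 (S1 ql qr)).
Proof.
intros Al Ar; destruct (Al) as [Hl _]; destruct (Ar) as [Hr _].
destruct (Rle_lt_or_eq_dec 0 (sh ql + sh qr)) as [Hw | Hw]; [lra | |].
- rewrite flux_h_jumps_l by assumption.
  assert (J := jumps_l_upper (S1 ql qr) (S2 ql qr) (S3 ql qr)
    (S1_le_ustar ql qr Al Ar Hw) (ustar_le_S3 ql qr Al Ar Hw) (sh ql) _ _ (sh qr)
    (hls_nonneg ql qr Al Ar Hw) (hrs_nonneg ql qr Al Ar Hw) Hr). lra.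
- assert (E := f_equal c1 (proj1 (fluxes_dry ql qr ltac:(lra) ltac:(lra)))).
  simpl in E; rewrite E; replace (sh ql) with 0 by lra; lra.
Qed.

Lemma flux_h_lower (ql qr : st) : admissible ql -> admissible qr ->
  sh qr * (su qr - Rmax 0 (S3 ql qr)) <= flux_h g eta_p lam ql qr.
Proof.
intros Al Ar; destruct (Al) as [Hl _]; destruct (Ar) as [Hr _].
destruct (Rle_lt_or_eq_dec 0 (sh ql + sh qr)) as [Hw | Hw]; [lra | |].
- rewrite flux_h_jumps_r by assumption.
  assert (J := jumps_r_upper (S1 ql qr) (S2 ql qr) (S3 ql qr)
    (S1_le_ustar ql qr Al Ar Hw) (ustar_le_S3 ql qr Al Ar Hw) (sh ql) _ _ (sh qr) Hl
    (hls_nonneg ql qr Al Ar Hw) (hrs_nonneg ql qr Al Ar Hw)). lra.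
- assert (E := f_equal c1 (proj1 (fluxes_dry ql qr ltac:(lra) ltac:(lra)))).
  simpl in E; rewrite E; replace (sh qr) with 0 by lra; lra.
Qed.

Lemma flux_w_upper (ql qr : st) (wl wls wrs wr : R) :
  admissible ql -> admissible qr -> 0 < sh ql + sh qr ->
  0 <= wls -> 0 <= wrs -> 0 <= wr ->
  flux_wl g eta_p lam ql qr wl wls wrs wr (wl * su ql)
  <= wl * (su ql - Rmin 0 (S1 ql qr)).
Proof.
intros Al Ar Hw H1 H2 H3.
assert (J := jumps_l_upper (S1 ql qr) (S2 ql qr) (S3 ql qr)
    (S1_le_ustar ql qr Al Ar Hw) (ustar_le_S3 ql qr Al Ar Hw) wl _ _ _ H1 H2 H3).
unfold flux_wl, jumps_l in *; lra.
Qed.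

Lemma flux_w_lower (ql qr : st) (wl wls wrs wr : R) :
  admissible ql -> admissible qr -> 0 < sh ql + sh qr ->
  0 <= wl -> 0 <= wls -> 0 <= wrs ->
  wr * (su qr - Rmax 0 (S3 ql qr))
  <= flux_wr g eta_p lam ql qr wl wls wrs wr (wr * su qr).
Proof.
intros Al Ar Hw H1 H2 H3.
assert (J := jumps_r_upper (S1 ql qr) (S2 ql qr) (S3 ql qr)
    (S1_le_ustar ql qr Al Ar Hw) (ustar_le_S3 ql qr Al Ar Hw) wl _ _ wr H1 H2 H3).
unfold flux_wr, jumps_r in *; lra.
Qed.

Lemma star_stresses_nonneg (ql qr : st) :
  admissible ql -> admissible qr -> 0 < sh ql + sh qr ->
  0 <= c3 (sol_qls g eta_p lam ql qr) /\ 0 <= c4 (sol_qls g eta_p lam ql qr) /\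
  0 <= c3 (sol_qrs g eta_p lam ql qr) /\ 0 <= c4 (sol_qrs g eta_p lam ql qr).
Proof.
intros Al Ar Hw.
assert (Hl := hls_nonneg ql qr Al Ar Hw); assert (Hr := hrs_nonneg ql qr Al Ar Hw).
destruct Al as (_ & ? & ?), Ar as (_ & ? & ?).
repeat split; simpl;
  unfold sol_sxxls, sol_sxxrs, sol_szzls, sol_szzrs;
  (apply Rmult_le_pos; [assumption | apply Rmult_le_pos; [assumption | apply pow2_ge_0]]).
Qed.

Lemma Sigma_bounds (ql qr : st) :
  - Rmin 0 (S1 ql qr) <= Aspeed g eta_p lam ql qr /\
  Rmax 0 (S3 ql qr) <= Aspeed g eta_p lam ql qr /\
  - S1 ql qr <= Aspeed g eta_p lam ql qr /\ S3 ql qr <= Aspeed g eta_p lam ql qr.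
Proof.
unfold Aspeed.
set (a := S1 ql qr); set (b := S2 ql qr); set (c := S3 ql qr).
assert (H1 := Rmax_l (Rabs a) (Rmax (Rabs b) (Rabs c))).
assert (H2 := Rmax_r (Rabs a) (Rmax (Rabs b) (Rabs c))).
assert (H3 := Rmax_r (Rabs b) (Rabs c)).
assert (H4 := Rle_abs c); assert (H5 := Rle_abs (- a)); rewrite Rabs_Ropp in H5.
assert (H6 := Rabs_pos a).
unfold Rmin, Rmax at 3; destruct (Rle_dec 0 a), (Rle_dec 0 c); repeat split; lra.
Qed.

(** For a given cell the first bound comes from its right interface and the second from its left
    one. *)
Lemma velocity_cfl (tau : R) (ql qr : st) :
  admissible ql -> admissible qr -> 0 <= tau -> tau * Aspeed g eta_p lam ql qr <= / 2 ->
  tau * su ql <= / 2 /\ - (tau * su qr) <= / 2.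
Proof.
intros Al Ar Ht HA; destruct (Sigma_bounds ql qr) as (_ & _ & B1 & B2).
assert (U := ul_le_S3 ql qr Al Ar); assert (V := S1_le_ur ql qr Al Ar).
assert (tau * su ql <= tau * Aspeed g eta_p lam ql qr) by (apply Rmult_le_compat_l; lra).
assert (tau * - su qr <= tau * Aspeed g eta_p lam ql qr) by (apply Rmult_le_compat_l; lra).
lra.
Qed.

Lemma outflow_l (tau : R) (ql qr : st) :
  admissible ql -> admissible qr -> 0 <= tau -> tau * Aspeed g eta_p lam ql qr <= / 2 ->
  let F := solFl g eta_p lam ql qr in
  tau * c1 F <= (/ 2 + tau * su ql) * c1 (cons ql) /\
  tau * c3 F <= (/ 2 + tau * su ql) * c3 (cons ql) /\
  tau * c4 F <= (/ 2 + tau * su ql) * c4 (cons ql).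
Proof.
intros Al Ar Ht HA F; destruct (Al) as (Hl & Xl & Zl); destruct (Ar) as (Hr & Xr & Zr).
destruct (Sigma_bounds ql qr) as (B & _).
destruct (Rle_lt_or_eq_dec 0 (sh ql + sh qr)) as [Hw | Hw]; [lra | |].
2:{ unfold F; rewrite (proj1 (fluxes_dry ql qr ltac:(lra) ltac:(lra))); simpl.
    replace (sh ql) with 0 by lra; lra. }
destruct (star_stresses_nonneg ql qr Al Ar Hw) as (Hls & Hls' & Hrs & Hrs').
repeat split;
  (eapply Rle_trans;
   [apply Rmult_le_compat_l; [exact Ht|] | apply half_cell_bound with (2 := HA) (3 := B); auto]).
- apply flux_h_upper; assumption.
- apply flux_w_upper; try assumption; simpl; apply Rmult_le_pos; assumption.
- simpl; apply Rmult_le_pos; assumption.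
- apply flux_w_upper; try assumption; simpl; apply Rmult_le_pos; assumption.
- simpl; apply Rmult_le_pos; assumption.
Qed.

Lemma outflow_r (tau : R) (ql qr : st) :
  admissible ql -> admissible qr -> 0 <= tau -> tau * Aspeed g eta_p lam ql qr <= / 2 ->
  let F := solFr g eta_p lam ql qr in
  - (tau * c1 F) <= (/ 2 - tau * su qr) * c1 (cons qr) /\
  - (tau * c3 F) <= (/ 2 - tau * su qr) * c3 (cons qr) /\
  - (tau * c4 F) <= (/ 2 - tau * su qr) * c4 (cons qr).
Proof.
intros Al Ar Ht HA F; destruct (Al) as (Hl & Xl & Zl); destruct (Ar) as (Hr & Xr & Zr).
destruct (Sigma_bounds ql qr) as (_ & B & _).
destruct (Rle_lt_or_eq_dec 0 (sh ql + sh qr)) as [Hw | Hw]; [lra | |].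
2:{ unfold F; rewrite (proj2 (fluxes_dry ql qr ltac:(lra) ltac:(lra))); simpl.
    replace (sh qr) with 0 by lra; lra. }
destruct (star_stresses_nonneg ql qr Al Ar Hw) as (Hls & Hls' & Hrs & Hrs').
assert (Step : forall f w, 0 <= w -> w * (su qr - Rmax 0 (S3 ql qr)) <= f ->
  - (tau * f) <= (/ 2 - tau * su qr) * w).
{ intros f w H0 H.
  assert (H1 := half_cell_bound tau _ (- su qr) w _ Ht HA B H0).
  assert (tau * (w * (su qr - Rmax 0 (S3 ql qr))) <= tau * f)
    by (apply Rmult_le_compat_l; assumption).
  lra. }
repeat split; apply Step.
- assumption.
- apply flux_h_lower; assumption.
- simpl; apply Rmult_le_pos; assumption.
- apply flux_w_lower; try assumption; simpl; apply Rmult_le_pos; assumption.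
- simpl; apply Rmult_le_pos; assumption.
- apply flux_w_lower; try assumption; simpl; apply Rmult_le_pos; assumption.
Qed.

Lemma recon_depth_l (ql qr : st) (db : R) :
  0 <= sh ql -> 0 <= sh (recon_l ql qr db) <= sh ql.
Proof.
intros H; simpl; unfold Rmax; repeat destruct (Rle_dec _ _); lra.
Qed.

Lemma recon_depth_r (ql qr : st) (db : R) :
  0 <= sh qr -> 0 <= sh (recon_r ql qr db) <= sh qr.
Proof.
intros H; simpl; unfold Rmax; repeat destruct (Rle_dec _ _); lra.
Qed.

Lemma recon_l_admissible (ql qr : st) (db : R) :
  admissible ql -> admissible (recon_l ql qr db).
Proof.
intros (H & Hx & Hz); split; [apply recon_depth_l, H | split; assumption].
Qed.

Lemma recon_r_admissible (ql qr : st) (db : R) :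
  admissible qr -> admissible (recon_r ql qr db).
Proof.
intros (H & Hx & Hz); split; [apply recon_depth_r, H | split; assumption].
Qed.

Lemma scheme_positivity : positivity g eta_p lam.
Proof.
intros dt dx b q Hdt Hdx Hq Hcfl i.
set (tau := dt / dx i).
assert (Htau : 0 <= tau) by (apply Rdiv_le_0_compat; auto).
assert (Cfl : forall A, dt * A <= / 2 * dx i -> tau * A <= / 2).
{ intros A HA; apply Rmult_le_reg_r with (dx i); [auto|].
  unfold tau; replace (dt / dx i * A * dx i) with (dt * A); [exact HA|].
  field; specialize (Hdx i); lra. }
assert (Hp := Hcfl i); assert (Hm := Hcfl (i - 1)%Z).
(* [CFL] at [i] speaks of the interface between [i] and [i + 1], so cell [i] is the right neighbour
   in the condition at [i - 1]. *)
unfold CFL in Hp, Hm; replace (i - 1 + 1)%Z with i in Hm by ring; cbv zeta in Hp, Hm.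
assert (Mp := Rmin_l (dx i) (dx (i + 1)%Z)); assert (Mm := Rmin_r (dx (i - 1)%Z) (dx i)).
set (dbp := b (i + 1)%Z - b i) in *; set (dbm := b i - b (i - 1)%Z) in *.
assert (Ai : admissible (q i)) by apply Hq.
set (lp := recon_l (q i) (q (i + 1)%Z) dbp) in *; set (rp := recon_r (q i) (q (i + 1)%Z) dbp) in *.
set (lm := recon_l (q (i - 1)%Z) (q i) dbm) in *; set (rm := recon_r (q (i - 1)%Z) (q i) dbm) in *.
assert (Alp : admissible lp) by apply recon_l_admissible, Hq.
assert (Arp : admissible rp) by apply recon_r_admissible, Hq.
assert (Alm : admissible lm) by apply recon_l_admissible, Hq.
assert (Arm : admissible rm) by apply recon_r_admissible, Hq.
assert (Cp : tau * Aspeed g eta_p lam lp rp <= / 2) by (apply Cfl; lra).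
assert (Cm : tau * Aspeed g eta_p lam lm rm <= / 2) by (apply Cfl; lra).
destruct (velocity_cfl tau lp rp Alp Arp Htau Cp) as [U1 _].
destruct (velocity_cfl tau lm rm Alm Arm Htau Cm) as [_ U2].
destruct (outflow_l tau lp rp Alp Arp Htau Cp) as (O1 & O3 & O4).
destruct (outflow_r tau lm rm Alm Arm Htau Cm) as (N1 & N3 & N4).
change (su lp) with (su (q i)) in *; change (su rm) with (su (q i)) in *.
destruct Ai as (Hh & Hx & Hz).
(* Reconstruction lowers the depth and keeps velocity and stresses, so [h] and [h sigma] of the
   reconstructed states stay below the cell values. *)
assert (Dl := proj2 (recon_depth_l (q i) (q (i + 1)%Z) dbp Hh)); fold lp in Dl.
assert (Dr := proj2 (recon_depth_r (q (i - 1)%Z) (q i) dbm Hh)); fold rm in Dr.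
assert (Dlx : c3 (cons lp) <= c3 (cons (q i))) by (apply Rmult_le_compat_r; assumption).
assert (Drx : c3 (cons rm) <= c3 (cons (q i))) by (apply Rmult_le_compat_r; assumption).
assert (Dlz : c4 (cons lp) <= c4 (cons (q i))) by (apply Rmult_le_compat_r; assumption).
assert (Drz : c4 (cons rm) <= c4 (cons (q i))) by (apply Rmult_le_compat_r; assumption).
unfold step, Fl, Fr; fold dbp dbm lp rp lm rm tau.
repeat split; cbn [c1 c3 c4 v4sub v4scal v4add]; rewrite !Rplus_0_r.
- apply (cell_update_nonneg tau (su (q i)) _ _ _ _ _ Dl Dr U1 U2 O1 N1).
- apply (cell_update_nonneg tau (su (q i)) _ _ _ _ _ Dlx Drx U1 U2 O3 N3).
- apply (cell_update_nonneg tau (su (q i)) _ _ _ _ _ Dlz Drz U1 U2 O4 N4).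
Qed.

(** * Conservation of mass and steady states at rest *)

Lemma scheme_conservative : conservative_h g eta_p lam.
Proof. intros ql qr db; reflexivity. Qed.

Lemma scheme_well_balanced : well_balanced g eta_p lam.
Proof.
intros dt dx b q H Hdx Hq i.
assert (Rest : forall j j', let db := b j' - b j in
  Fl g eta_p lam (q j) (q j') db = mkv4 0 (g * sh (q j) ^ 2 / 2) 0 0 /\
  Fr g eta_p lam (q j) (q j') db = mkv4 0 (g * sh (q j') ^ 2 / 2) 0 0).
{ intros j j' db.
  destruct (Hq j) as (Hh & Hu & Hb & Hx & Hz), (Hq j') as (Hh' & Hu' & Hb' & Hx' & Hz').
  (* When [h + b] is constant both reconstructed depths equal the smaller of the two depths. The
     solver then returns the exact flux at rest, and the correction replaces its hydrostatic
     pressure by that of the cell. *)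
  assert (E : recon_l (q j) (q j') db = recon_r (q j) (q j') db).
  { unfold recon_l, recon_r; rewrite Hu, Hu', Hx, Hx', Hz, Hz'; f_equal.
    unfold Rmax; repeat destruct (Rle_dec _ _); unfold db in *; lra. }
  unfold Fl, Fr; rewrite <- E.
  destruct (fluxes_diag (recon_l (q j) (q j') db)) as [-> ->].
  { split; [apply recon_depth_l, Hh | simpl; lra]. }
  set (h := sh (recon_l (q j) (q j') db)).
  unfold Flux, v4add, Pres; fold h; simpl su; simpl sxx; simpl szz.
  rewrite Hu, Hx, Hz; cbn [c1 c2 c3 c4]; split; f_equal; field; lra. }
destruct (Rest i (i + 1)%Z) as [Ep _]; destruct (Rest (i - 1)%Z i) as [_ Em].
unfold step; rewrite Ep, Em.
unfold v4sub, v4scal, cons; cbn [c1 c2 c3 c4]; f_equal; ring.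
Qed.

(** * Energy inequality with topography *)

Lemma Etil_energy (q : st) (b : R) : wet q ->
  Etil g eta_p lam q b = energy q + g * sh q * b.
Proof.
intros (Hh & Hx & Hz); unfold Etil, Etc, energy, specific_energy; cbn [c1 c2 c3 c4 cons].
replace (sh q * sxx q / sh q) with (sxx q) by (field; lra).
replace (sh q * szz q / sh q) with (szz q) by (field; lra).
field; lra.
Qed.

(** Passes from the derivative, whose formula divides by [h], to [dE], which can also be evaluated
    at dry reconstructed states. *)
Lemma dEtil_dot_dE (q : st) (b : R) (v : v4) : wet q ->
  dEtil_dot g eta_p lam q b v = dE q v + g * b * c1 v.
Proof.
intros (Hh & Hx & Hz); unfold dEtil_dot; cbv zeta.
set (h := sh q) in *; set (m := c2 (cons q)); set (X := c3 (cons q)); set (Z := c4 (cons q)).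
assert (HX : X / h = sxx q) by (unfold X, h; simpl; field; unfold h in Hh; lra).
assert (HZ : Z / h = szz q) by (unfold Z, h; simpl; field; unfold h in Hh; lra).
assert (Hm : m / h = su q) by (unfold m, h; simpl; field; unfold h in Hh; lra).
change (c1 (cons q)) with h.
assert (X0 : 0 < X) by (apply Rmult_lt_0_compat; assumption).
assert (Z0 : 0 < Z) by (apply Rmult_lt_0_compat; assumption).
assert (HXZ : 0 < X / h * (Z / h)) by (rewrite HX, HZ; apply Rmult_lt_0_compat; assumption).
assert (D1 : Derive (fun x => Etc g eta_p lam x m X Z b) h
  = - (m / h) ^ 2 / 2 + g * h - k / 2 * ln (X / h * (Z / h)) + g * b).
{ apply is_derive_unique; unfold Etc; auto_derive; [repeat split; lra|].
  unfold Rdiv; set (L := ln _); field; lra. }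
assert (D2 : Derive (fun x => Etc g eta_p lam h x X Z b) m = m / h).
{ apply is_derive_unique; unfold Etc; auto_derive; [repeat split; lra|].
  field; lra. }
assert (D3 : Derive (fun x => Etc g eta_p lam h m x Z b) X = k / 2 * (1 - / (X / h))).
{ apply is_derive_unique; unfold Etc; auto_derive; [repeat split; lra|].
  field; lra. }
assert (D4 : Derive (fun x => Etc g eta_p lam h m X x b) Z = k / 2 * (1 - / (Z / h))).
{ apply is_derive_unique; unfold Etc; auto_derive; [repeat split; lra|].
  field; lra. }
rewrite D1, D2, D3, D4, HX, HZ, Hm.
unfold dE, h; ring.
Qed.

(** The momentum correction, multiplied by [u], changes the term [g h^2/2 u] of
    [energy_flux_legendre] at the cell into the one at the reconstructed state. Each bound becomes
    the homogeneous one plus [g (h + b - h^#)] times the mass flux. *)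
Lemma energy_inequality_topography (ql qr : st) (bl br : R) : wet ql -> wet qr ->
  Gtil g eta_p lam qr br
  + dEtil_dot g eta_p lam qr br (v4sub (Fr g eta_p lam ql qr (br - bl)) (Flux g eta_p lam qr))
  <= Gtil g eta_p lam ql bl
  + dEtil_dot g eta_p lam ql bl (v4sub (Fl g eta_p lam ql qr (br - bl)) (Flux g eta_p lam ql)).
Proof.
intros Wl Wr; rewrite !dEtil_dot_dE by assumption.
assert (Sl : stressed ql) by (destruct Wl; split; [lra | assumption]).
assert (Sr : stressed qr) by (destruct Wr; split; [lra | assumption]).
assert (Legl := energy_flux_legendre ql Sl); assert (Legr := energy_flux_legendre qr Sr).
set (db := br - bl).
assert (Rl : stressed (recon_l ql qr db)).
{ destruct Sl as (? & ? & ?); split; [apply recon_depth_l; assumption | split; assumption]. }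
assert (Rr : stressed (recon_r ql qr db)).
{ destruct Sr as (? & ? & ?); split; [apply recon_depth_r; assumption | split; assumption]. }
destruct (Wl) as [Hl _]; destruct (Wr) as [Hr _].
(* Only one of the two depths is cut, according to the sign of [db], so the other state stays
   wet. *)
assert (Hwet : 0 < sh (recon_l ql qr db) + sh (recon_r ql qr db)).
{ simpl; unfold Rmax; repeat destruct (Rle_dec _ _); lra. }
assert (Hom := homogeneous_energy_inequality _ _ Rl Rr Hwet).
assert (Bl := flux_h_upper _ _ (stressed_admissible _ Rl) (stressed_admissible _ Rr)).
assert (Br := flux_h_lower _ _ (stressed_admissible _ Rl) (stressed_admissible _ Rr)).
(* When a reconstructed state is dry the mass flux can only enter it; otherwise
   h + b - h^# is the same on both sides. *)
assert (Sign : (sh qr + br - sh (recon_r ql qr db))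
    * flux_h g eta_p lam (recon_l ql qr db) (recon_r ql qr db)
  <= (sh ql + bl - sh (recon_l ql qr db))
    * flux_h g eta_p lam (recon_l ql qr db) (recon_r ql qr db)).
{ set (f := flux_h g eta_p lam (recon_l ql qr db) (recon_r ql qr db)) in *.
  assert (Cases : sh qr + br - sh (recon_r ql qr db) = sh ql + bl - sh (recon_l ql qr db)
    \/ (sh (recon_l ql qr db) = 0 /\
        sh ql + bl - sh (recon_l ql qr db) <= sh qr + br - sh (recon_r ql qr db))
    \/ (sh (recon_r ql qr db) = 0 /\
        sh qr + br - sh (recon_r ql qr db) <= sh ql + bl - sh (recon_l ql qr db))).
  { simpl; unfold Rmax, db; repeat destruct (Rle_dec _ _);
      (left; lra) || (right; left; lra) || (right; right; lra). }
  destruct Cases as [-> | [[E Le] | [E Le]]]; [lra | |].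
  - rewrite E in Bl; nra.
  - rewrite E in Br; nra. }
clear Bl Br.
set (Fs := flux_h g eta_p lam (recon_l ql qr db) (recon_r ql qr db)) in *.
revert Hom Legl Legr.
unfold Gtil, Eng; rewrite !Etil_energy by assumption.
unfold Fl, Fr.
unfold dE, v4sub, v4add; cbn [c1 c2 c3 c4 solFl solFr Flux].
fold Fs.
simpl su; simpl sxx; simpl szz.
set (hl := sh (recon_l ql qr db)) in *; set (hr := sh (recon_r ql qr db)) in *.
assert (Sg := Rmult_le_compat_l g _ _ (Rlt_le _ _ Hg) Sign).
revert Sg; clear.
set (f2 := flux_hu _ _ _ _ _); set (f3l := flux_wl _ _ _ _ _ _ _ _ _ _);
set (f3r := flux_wr _ _ _ _ _ _ _ _ _ _).
set (f4l := flux_wl _ _ _ _ _ _ _ _ _ _).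
set (f4r := flux_wr _ _ _ _ _ _ _ _ _ _).
intros; lra.
Qed.

Lemma fluxes_consistent (q : st) : wet q ->
  Fl g eta_p lam q q 0 = Flux g eta_p lam q /\ Fr g eta_p lam q q 0 = Flux g eta_p lam q.
Proof.
intros (Hh & Hs).
assert (El : recon_l q q 0 = q).
{ destruct q; unfold recon_l; simpl in *; f_equal; unfold Rmax; repeat destruct (Rle_dec _ _); lra. }
assert (Er : recon_r q q 0 = q).
{ destruct q; unfold recon_r; simpl in *; f_equal; unfold Rmax; repeat destruct (Rle_dec _ _); lra. }
unfold Fl, Fr; rewrite El, Er.
destruct (fluxes_diag q) as [-> ->]; [split; [lra | exact Hs]|].
split; unfold v4add, Flux; cbn [c1 c2 c3 c4]; f_equal; lra.
Qed.

(* The upper bound itself serves as the numerical energy flux. *)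
Lemma scheme_energy_inequality : energy_inequality g eta_p lam.
Proof.
exists (fun ql qr bl br => Gtil g eta_p lam ql bl
  + dEtil_dot g eta_p lam ql bl (v4sub (Fl g eta_p lam ql qr (br - bl)) (Flux g eta_p lam ql))).
split.
- intros q b Hq; rewrite Rminus_diag, (proj1 (fluxes_consistent q Hq)).
  rewrite dEtil_dot_dE by assumption.
  unfold dE, v4sub; cbn [c1 c2 c3 c4]; ring.
- intros ql qr bl br Hl Hr; split; [apply energy_inequality_topography; assumption | lra].
Qed.

(** * Consistency *)

(** Across an outer wave [h / h^* = 1 + t] with [t = d / s], so the gap it contributes is
    [w s ((1 + t)^2 - 1)] for [sigma_xx] and [w s ((1 + t)^(-2) - 1)] for [sigma_zz]. Both are
    displayed as a linear term [2 d] plus a quadratic remainder. *)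
Lemma stress_gaps (ql qr : st) :
  admissible ql -> admissible qr -> 0 < sh ql -> 0 < sh qr ->
  let dl := us ql qr - su ql in let dr := su qr - us ql qr in
  let tl := dl / sl ql qr in let tr := dr / sr ql qr in
  let D := v4sub (solFr g eta_p lam ql qr) (solFl g eta_p lam ql qr) in
  c3 D = c3 (cons ql) * (2 * dl + dl ^ 2 / sl ql qr)
         + c3 (cons qr) * (2 * dr + dr ^ 2 / sr ql qr) /\
  c4 D = - (c4 (cons ql) * (2 * dl - dl ^ 2 / sl ql qr * ((3 + 2 * tl) / (1 + tl) ^ 2))
            + c4 (cons qr) * (2 * dr - dr ^ 2 / sr ql qr * ((3 + 2 * tr) / (1 + tr) ^ 2))).
Proof.
intros Al Ar Hl Hr dl dr tl tr D.
assert (Hw : 0 < sh ql + sh qr) by lra.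
assert (Ml := mass_jump_l ql qr Al Ar Hw); assert (Mr := mass_jump_r ql qr Al Ar Hw).
assert (Pl := hls_pos ql qr Al Ar Hw Hl); assert (Pr := hrs_pos ql qr Al Ar Hw Hr).
assert (Sl : 0 < sl ql qr).
{ rewrite sl_drop; assert (H := drop_l_nonneg ql qr Al Ar).
  assert (H1 := al_pos ql Al Hl); lra. }
assert (Sr : 0 < sr ql qr).
{ rewrite sr_drop; assert (H := drop_r_nonneg ql qr Al Ar).
  assert (H1 := al_pos qr Ar Hr); change (ar qr) with (al qr); lra. }
assert (El : sh ql / hls ql qr = 1 + tl).
{ apply Rmult_eq_reg_r with (hls ql qr * sl ql qr); [|nra].
  replace (sh ql / hls ql qr * (hls ql qr * sl ql qr)) with (cl ql qr) by (unfold sol_cl; field; lra).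
  rewrite <- Ml; unfold tl, dl, Sig1; field; lra. }
assert (Er : sh qr / hrs ql qr = 1 + tr).
{ apply Rmult_eq_reg_r with (hrs ql qr * sr ql qr); [|nra].
  replace (sh qr / hrs ql qr * (hrs ql qr * sr ql qr)) with (cr ql qr) by (unfold sol_cr; field; lra).
  rewrite <- Mr; unfold tr, dr, Sig3; field; lra. }
assert (Tl : 0 < 1 + tl) by (rewrite <- El; apply Rdiv_lt_0_compat; assumption).
assert (Tr : 0 < 1 + tr) by (rewrite <- Er; apply Rdiv_lt_0_compat; assumption).
assert (Hls : hls ql qr = sh ql / (1 + tl)) by (rewrite <- El; field; lra).
assert (Hrs : hrs ql qr = sh qr / (1 + tr)) by (rewrite <- Er; field; lra).
assert (Dl : dl = tl * sl ql qr) by (unfold tl; field; lra).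
assert (Dr : dr = tr * sr ql qr) by (unfold tr; field; lra).
assert (B : forall wl wls wrs wr,
  flux_wr g eta_p lam ql qr wl wls wrs wr (wr * su qr)
  - flux_wl g eta_p lam ql qr wl wls wrs wr (wl * su ql)
  = wls * (dl + sl ql qr) - wl * sl ql qr + (wrs * (dr + sr ql qr) - wr * sr ql qr)).
{ intros; assert (J := jumps_l_r (S1 ql qr) (S2 ql qr) (S3 ql qr) wl wls wrs wr).
  unfold flux_wr, flux_wl, jumps_l, jumps_r, Sig1, Sig2, Sig3, dl, dr in *; lra. }
unfold D; cbn [v4sub c3 c4 solFr solFl Flux cons sol_qls sol_qrs].
rewrite !B.
unfold sol_sxxls, sol_sxxrs, sol_szzls, sol_szzrs.
rewrite Hls, Hrs, Dl, Dr. clear - Sl Sr Tl Tr Hl Hr.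
split; field; repeat split; lra.
Qed.

(** Away from vacuum the impedance is at least [H / 2 * a] and the pressure is Lipschitz; [K] is one
    plus the quotient of the two constants. *)
Lemma contact_velocity_lipschitz (ql qr : st) (H B d : R) :
  0 < H -> wet ql -> wet qr ->
  H / 2 <= sh ql <= 2 * H -> H / 2 <= sh qr <= 2 * H ->
  sxx ql <= B -> szz ql <= B ->
  Rabs (sh qr - sh ql) <= d -> Rabs (su qr - su ql) <= d ->
  Rabs (sxx qr - sxx ql) <= d -> Rabs (szz qr - szz ql) <= d ->
  let a := sqrt (g * (H / 2)) in
  let K := 1 + (2 * g * H + k * B + 4 * k * H) / (H / 2 * a) in
  a <= sl ql qr /\ a <= sr ql qr /\
  Rabs (us ql qr - su ql) <= K * d /\ Rabs (su qr - us ql qr) <= K * d.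
Proof.
intros H0 (Wl & Xl & Zl) (Wr & Xr & Zr) Hl Hr HX HZ Dh Du Dx Dz a K.
assert (Hk := k_pos).
assert (Al : admissible ql) by (repeat split; lra).
assert (Ar : admissible qr) by (repeat split; lra).
assert (Hw : 0 < sh ql + sh qr) by lra.
assert (Ha : 0 < a) by (apply sqrt_lt_R0, Rmult_lt_0_compat; lra).
assert (Hal : a <= al ql) by (apply sqrt_le_1_alt; unfold dhP; nra).
assert (Har : a <= al qr) by (apply sqrt_le_1_alt; unfold dhP; nra).
assert (Nl := drop_l_nonneg ql qr Al Ar); assert (Nr := drop_r_nonneg ql qr Al Ar).
assert (C1 := cl_ge ql qr Al Ar); assert (C2 := cr_ge ql qr Al Ar).
assert (Z1 : 0 < H / 2 * a) by (apply Rmult_lt_0_compat; lra).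
assert (Y1 : H / 2 * a <= cl ql qr).
{ apply Rle_trans with (2 := C1); apply Rmult_le_compat; lra. }
assert (Y2 : 0 <= cr ql qr).
{ apply Rle_trans with (2 := C2), qr_impedance_nonneg; assumption. }
assert (DP : Rabs (P qr - P ql) <= (2 * g * H + k * B + 4 * k * H) * d).
{ replace (P qr - P ql) with ((g * ((sh ql + sh qr) / 2) + k * (szz ql - sxx ql)) * (sh qr - sh ql)
    + k * sh qr * ((szz qr - szz ql) - (sxx qr - sxx ql))) by (unfold Pres; field; lra).
  assert (Hd : 0 <= d) by (apply Rle_trans with (2 := Dh), Rabs_pos).
  apply Rle_trans with (1 := Rabs_triang _ _); rewrite !Rabs_mult.
  assert (E1 : Rabs (g * ((sh ql + sh qr) / 2) + k * (szz ql - sxx ql)) <= 2 * g * H + k * B).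
  { apply Rle_trans with (1 := Rabs_triang _ _); rewrite !Rabs_mult.
    rewrite (Rabs_right g), (Rabs_right k), (Rabs_right ((sh ql + sh qr) / 2)) by lra.
    assert (Rabs (szz ql - sxx ql) <= B) by (apply Rabs_le; lra).
    assert (k * Rabs (szz ql - sxx ql) <= k * B) by (apply Rmult_le_compat_l; lra).
    assert (g * ((sh ql + sh qr) / 2) <= g * (2 * H)) by (apply Rmult_le_compat_l; lra).
    lra. }
  assert (E2 : Rabs (szz qr - szz ql - (sxx qr - sxx ql)) <= 2 * d).
  { apply Rle_trans with (1 := Rabs_triang _ _); rewrite Rabs_Ropp; lra. }
  rewrite (Rabs_right k), (Rabs_right (sh qr)) by lra.
  assert (E3 := Rmult_le_compat _ _ _ _ (Rabs_pos _) (Rabs_pos _) E1 Dh).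
  assert (E4 : k * sh qr * Rabs (szz qr - szz ql - (sxx qr - sxx ql)) <= k * (2 * H) * (2 * d)).
  { apply Rmult_le_compat; [nra | apply Rabs_pos | apply Rmult_le_compat_l; lra | exact E2]. }
  lra. }
assert (DPs : Rabs (P qr - P ql) / (H / 2 * a)
  <= (2 * g * H + k * B + 4 * k * H) / (H / 2 * a) * d).
{ unfold Rdiv at 1 3; rewrite Rmult_assoc, (Rmult_comm (/ _) d), <- Rmult_assoc.
  apply Rmult_le_compat_r; [left; apply Rinv_0_lt_compat; lra | exact DP]. }
change (ar qr) with (al qr) in *.
repeat split.
- rewrite sl_drop; lra.
- rewrite sr_drop; change (ar qr) with (al qr); lra.
- rewrite ustar_minus_ul by assumption.
  eapply Rle_trans; [apply contact_velocity_abs with (s := H / 2 * a); lra|].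
  rewrite (Rabs_minus_sym (P ql)); unfold K; lra.
- rewrite ur_minus_ustar by assumption.
  eapply Rle_trans; [apply contact_velocity_abs with (s := H / 2 * a); lra|].
  unfold K; lra.
Qed.

(** Only the depth on the side with the lower bottom is cut, by [|db|], and the outer positive part
    is inactive. A difference of squares then gives [- g db] times the mean of the cut and uncut
    depths. *)
Lemma bottom_pressure_gap (hl hr db : R) : Rabs db <= hl -> Rabs db <= hr ->
  let hl' := Rmax 0 (hl - Rmax 0 db) in let hr' := Rmax 0 (hr - Rmax 0 (- db)) in
  forall H e, Rabs (hl - H) <= e -> Rabs (hr - H) <= e -> Rabs db <= e ->
  Rabs (g * hr ^ 2 / 2 - g * hr' ^ 2 / 2 - (g * hl ^ 2 / 2 - g * hl' ^ 2 / 2) - - g * H * db)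
  <= 2 * g * e * Rabs db.
Proof.
intros L1 L2 hl' hr' H e El Er Eb.
assert (A := Rabs_pos db).
assert (He : 0 <= e) by lra.
apply Rabs_le_between in El; apply Rabs_le_between in Er.
assert (Eb' := Eb); apply Rabs_le_between in Eb'.
assert (Cases : exists m, Rabs m <= 2 * e /\
  g * hr ^ 2 / 2 - g * hr' ^ 2 / 2 - (g * hl ^ 2 / 2 - g * hl' ^ 2 / 2) - - g * H * db
  = g * m * db).
{ destruct (Rle_lt_dec 0 db) as [Hd | Hd].
  - rewrite Rabs_right in L1, L2 by lra.
    exists (H - hl + db / 2); split; [apply Rabs_le; lra|].
    unfold hl', hr'; rewrite (Rmax_right 0 db), (Rmax_left 0 (- db)) by lra.
    rewrite !Rmax_right by lra; field.
  - rewrite Rabs_left in L1, L2 by lra.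
    exists (H - hr - db / 2); split; [apply Rabs_le; lra|].
    unfold hl', hr'; rewrite (Rmax_left 0 db), (Rmax_right 0 (- db)) by lra.
    rewrite !Rmax_right by lra; field. }
destruct Cases as (m & Hm & ->).
rewrite !Rabs_mult, (Rabs_right g) by lra.
apply Rmult_le_compat_r; [exact A|].
replace (2 * g * e) with (g * (2 * e)) by ring.
apply Rmult_le_compat_l; lra.
Qed.

Lemma scheme_consistent : consistency g eta_p lam.
Proof.
split; [exact fluxes_consistent|].
intros q (Hh & Hx & Hz) eps Heps.
assert (Hk := k_pos).
set (H := sh q) in *; set (X := sxx q) in *; set (Z := szz q) in *.
set (B := X + Z + 1).
set (a := sqrt (g * (H / 2))).
assert (Ha : 0 < a) by (apply sqrt_lt_R0, Rmult_lt_0_compat; lra).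
set (K := 1 + (2 * g * H + k * B + 4 * k * H) / (H / 2 * a)).
assert (HB : 0 < B) by (unfold B; lra).
assert (HK : 0 < K).
{ unfold K; apply Rplus_lt_0_compat; [lra|]; apply Rdiv_lt_0_compat;
    [|apply Rmult_lt_0_compat; lra].
  assert (0 < g * H) by (apply Rmult_lt_0_compat; lra).
  assert (0 < k * B) by (apply Rmult_lt_0_compat; lra).
  assert (0 < k * H) by (apply Rmult_lt_0_compat; lra). lra. }
set (W := 2 * H * B); set (M := 2 * B + H).
(* The constant of [expansion_error] for [om = M * delta] and [rho = 3 * K * delta]; [W] bounds
   [h sigma], and [M * delta] bounds its deviation from the value at [q]. *)
set (C := K * (4 * M + 96 * W * K / a)).
assert (HW : 0 < W) by (unfold W; apply Rmult_lt_0_compat; lra).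
assert (HC : 0 < C).
{ unfold C; apply Rmult_lt_0_compat; [lra|]; apply Rplus_lt_0_compat; [unfold M; lra|].
  apply Rdiv_lt_0_compat; [apply Rmult_lt_0_compat; lra | lra]. }
(* In order: stresses below [B], reconstructed depths between [H / 2] and [2 * H], positive
   stresses, velocity increments at most [a / 2], then the momentum error and the stress errors. *)
assert (Hdelta : exists delta, 0 < delta /\ delta <= 1 /\ delta <= H / 4 /\ delta <= X /\
  delta <= Z /\ delta <= a / (6 * K) /\ delta <= eps / (2 * g) /\ delta <= eps / C).
{ exists (Rmin 1 (Rmin (H / 4) (Rmin X (Rmin Z (Rmin (a / (6 * K))
    (Rmin (eps / (2 * g)) (eps / C))))))).
  split.
  - repeat apply Rmin_pos; try assumption; try lra; apply Rdiv_lt_0_compat; lra.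
  - repeat split;
      repeat (first [apply Rmin_l | apply Rmin_r | eapply Rle_trans; [apply Rmin_r|]]). }
destruct Hdelta as (delta & D0 & D1 & DH & DX & DZ & DK & Dg & DC).
exists delta; split; [exact D0|].
intros ql qr db Pl Pr Pb D err.
assert (KD : 3 * K * delta <= a / 2).
{ apply Rmult_le_compat_l with (r := 3 * K) in DK; [|lra].
  replace (3 * K * (a / (6 * K))) with (a / 2) in DK by (field; lra). exact DK. }
assert (gD : 2 * g * delta <= eps).
{ apply Rmult_le_compat_l with (r := 2 * g) in Dg; [|lra].
  replace (2 * g * (eps / (2 * g))) with eps in Dg by (field; lra). exact Dg. }
assert (CD : C * delta <= eps).
{ apply Rmult_le_compat_l with (r := C) in DC; [|lra].
  replace (C * (eps / C)) with eps in DC by (field; lra). exact DC. }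
set (d := pdist qr ql + Rabs db).
assert (Tri := pdist_triangle qr q ql).
assert (Ab := Rabs_pos db).
destruct (pdist_components ql q delta) as (Lh & Lu & Lx & Lz); [lra|].
destruct (pdist_components qr q delta) as (Rh & Ru & Rx & Rz); [lra|].
destruct (pdist_components qr ql (pdist qr ql)) as (Ch & Cu & Cx & Cz); [lra|].
assert (Hd : 0 <= d <= 3 * delta).
{ assert (X0 := Rle_trans _ _ _ (Rabs_pos _) Ch). unfold d; lra. }
fold H in Lh, Rh; fold X in Lx, Rx; fold Z in Lz, Rz.
assert (Bb := Rlt_le _ _ Pb); apply Rabs_le_between in Bb.
assert (Lh' := Lh); apply Rabs_le_between in Lh'.
assert (Rh' := Rh); apply Rabs_le_between in Rh'.
assert (Lx' := Lx); apply Rabs_le_between in Lx'.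
assert (Rx' := Rx); apply Rabs_le_between in Rx'.
assert (Lz' := Lz); apply Rabs_le_between in Lz'.
assert (Rz' := Rz); apply Rabs_le_between in Rz'.
(* Since [delta] may equal [X], positivity uses the strict bound on [pdist]. *)
assert (Xl : 0 < sxx ql).
{ destruct (pdist_components ql q (pdist ql q)) as (_ & _ & V & _); [lra|].
  apply Rabs_le_between in V; fold X in V; lra. }
assert (Xr : 0 < sxx qr).
{ destruct (pdist_components qr q (pdist qr q)) as (_ & _ & V & _); [lra|].
  apply Rabs_le_between in V; fold X in V; lra. }
assert (Zl : 0 < szz ql).
{ destruct (pdist_components ql q (pdist ql q)) as (_ & _ & _ & V); [lra|].
  apply Rabs_le_between in V; fold Z in V; lra. }
assert (Zr : 0 < szz qr).
{ destruct (pdist_components qr q (pdist qr q)) as (_ & _ & _ & V); [lra|].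
  apply Rabs_le_between in V; fold Z in V; lra. }
set (pl := recon_l ql qr db); set (pr := recon_r ql qr db).
(* Reconstruction shifts the depth difference by exactly [db], which is why the error scale [d]
   contains [Rabs db]. *)
assert (Depth : H - 2 * delta <= sh pl <= H + delta /\ H - 2 * delta <= sh pr <= H + delta
  /\ sh pr - sh pl = sh qr - sh ql + db).
{ unfold pl, pr; simpl; unfold Rmax; repeat destruct (Rle_dec _ _); lra. }
destruct Depth as (Depl & Depr & Depd).
assert (Dh : Rabs (sh pr - sh pl) <= d).
{ rewrite Depd; apply Rle_trans with (1 := Rabs_triang _ _); unfold d; lra. }
assert (Wpl : wet pl) by (split; [lra | split; assumption]).
assert (Wpr : wet pr) by (split; [lra | split; assumption]).
destruct (contact_velocity_lipschitz pl pr H B d Hh Wpl Wpr) as (Sl & Sr & Vl & Vr);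
  try lra; try (change (su pl) with (su ql); change (su pr) with (su qr);
    change (sxx pl) with (sxx ql); change (sxx pr) with (sxx qr);
    change (szz pl) with (szz ql); change (szz pr) with (szz qr); unfold B, d; lra).
fold a in Sl, Sr; fold a K in Vl, Vr.
destruct (stress_gaps pl pr) as [G3 G4]; try (repeat split; simpl; lra); try lra.
{ destruct Wpl as (? & ? & ?); repeat split; lra. }
{ destruct Wpr as (? & ? & ?); repeat split; lra. }
assert (Kd : K * d <= 3 * K * delta).
{ replace (3 * K * delta) with (K * (3 * delta)) by ring; apply Rmult_le_compat_l; lra. }
assert (Final : (4 * (M * delta) + 32 * W * (3 * K * delta) / a) * (K * d) <= eps * d).
{ replace ((4 * (M * delta) + 32 * W * (3 * K * delta) / a) * (K * d))
    with (C * delta * d) by (unfold C; field; lra).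
  apply Rmult_le_compat_r; lra. }
assert (Hrho : 0 <= 3 * K * delta) by (repeat apply Rmult_le_pos; lra).
assert (Hdu : su qr - su ql = us pl pr - su pl + (su pr - us pl pr)) by (simpl; ring).
assert (Ol : Rabs (sh pl - H) <= 2 * delta) by (apply Rabs_le; lra).
assert (Or : Rabs (sh pr - H) <= 2 * delta) by (apply Rabs_le; lra).
assert (Prod : forall h x X0, 0 <= x <= B -> Rabs (h - H) <= 2 * delta ->
  Rabs (x - X0) <= delta -> Rabs (h * x - H * X0) <= M * delta).
{ intros h x X0 V1 V2 V3.
  replace (M * delta) with (2 * delta * B + H * delta) by (unfold M; ring).
  apply product_error; lra. }
assert (Bd : forall h x, 0 <= h <= 2 * H -> 0 <= x <= B -> 0 <= h * x <= W).
{ intros h x V1 V2; split; [apply Rmult_le_pos; lra | apply Rmult_le_compat; lra]. }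
unfold D, Fl, Fr; fold pl pr; unfold err; fold d.
cbn [v4sub v4add c1 c2 c3 c4]; rewrite !Rplus_0_r.
cbn [v4sub c3 c4] in G3, G4.
repeat split.
- change (c1 (solFr g eta_p lam pl pr)) with (c1 (solFl g eta_p lam pl pr)).
  rewrite Rminus_diag, Rabs_R0; apply Rmult_le_pos; lra.
- change (c2 (solFr g eta_p lam pl pr)) with (c2 (solFl g eta_p lam pl pr)).
  set (f := c2 (solFl g eta_p lam pl pr)).
  replace (f + (g * sh qr ^ 2 / 2 - g * sh pr ^ 2 / 2)
           - (f + (g * sh ql ^ 2 / 2 - g * sh pl ^ 2 / 2)))
    with (g * sh qr ^ 2 / 2 - g * sh pr ^ 2 / 2 - (g * sh ql ^ 2 / 2 - g * sh pl ^ 2 / 2)) by ring.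
  eapply Rle_trans.
  + apply (bottom_pressure_gap (sh ql) (sh qr) db) with (e := delta); lra.
  + apply Rmult_le_compat; try lra; [repeat apply Rmult_le_pos; lra|].
    assert (X0 := Rle_trans _ _ _ (Rabs_pos _) Ch). unfold d; lra.
- rewrite G3; eapply Rle_trans; [|exact Final].
  replace (2 * H * X * (su qr - su ql)) with (2 * (H * X) * (su qr - su ql)) by ring.
  apply expansion_error; try assumption; try lra.
  + apply Prod; simpl; unfold B; lra || assumption.
  + apply Prod; simpl; unfold B; lra || assumption.
  + apply Bd; simpl; unfold B; simpl in *; lra.
  + apply Bd; simpl; unfold B; simpl in *; lra.
  + apply quadratic_remainder_xx; lra.
  + apply quadratic_remainder_xx; lra.
- rewrite G4; eapply Rle_trans; [|exact Final].
  rewrite <- Rabs_Ropp.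
  match goal with |- Rabs (- (- (?wl * (2 * ?dl - ?el) + ?wr * (2 * ?dr - ?er)) - _)) <= _ =>
    replace (- (- (wl * (2 * dl - el) + wr * (2 * dr - er)) - (- 2 * H * Z * (su qr - su ql))))
      with (wl * (2 * dl + - el) + wr * (2 * dr + - er) - 2 * (H * Z) * (su qr - su ql)) by ring
  end.
  apply expansion_error; try assumption; try lra.
  + apply Prod; simpl; unfold B; lra || assumption.
  + apply Prod; simpl; unfold B; lra || assumption.
  + apply Bd; simpl; unfold B; simpl in *; lra.
  + apply Bd; simpl; unfold B; simpl in *; lra.
  + apply quadratic_remainder_zz; lra.
  + apply quadratic_remainder_zz; lra.
Qed.

End Scheme.

Theorem theorem2 (g eta_p lam : R) (Hg : 0 < g) (Heta : 0 < eta_p) (Hlam : 0 < lam) :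
  consistency g eta_p lam /\
  positivity g eta_p lam /\
  conservative_h g eta_p lam /\
  energy_inequality g eta_p lam /\
  well_balanced g eta_p lam.
Proof.
split; [|split; [|split; [|split]]].
- apply scheme_consistent; assumption.
- apply scheme_positivity; assumption.
- apply scheme_conservative.
- apply scheme_energy_inequality; assumption.
- apply scheme_well_balanced; assumption.
Qed.
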